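(* Let $\lambda^*$ be the solution of the equation $$E\left\{\max\left\{\tfrac{T}{2}R_n-\lambda T,\,0\right\}\right\}=\frac{\lambda\tau}{p_s}$$ in the unknown $\lambda\ge 0$ (the left-hand side does not depend on $n$). Then the stopping rule $$N^*=\min\{n\ge 1: R_n\ge 2\lambda^*\}$$ is optimal, i.e. it achieves the maximal system throughput: $$\frac{E(Y_{N^*})}{E(T_{N^*})}=\sup_{N}\frac{E(Y_N)}{E(T_N)},$$ where the supremum is over all stopping rules $N$.
   Context: Let $K,L\ge 1$ be integers (numbers of source-destination pairs and of relays), let $T,\tau,P_s,P_r,\sigma_f^2,\sigma_g^2>0$ be constants, let $p_0\in(0,1)$, and put $p_s=Kp_0(1-p_0)^{K-1}$. Observations are indexed by $n=1,2,\dots$. In observation $n$: the winner $s(n)$ is uniformly distributed on $\{1,\dots,K\}$; the number of contention slots $K_n$ is geometric, $\mathrm{Prob}(K_n=k)=p_s(1-p_s)^{k-1}$, $k\ge1$; the channel gains $f_{ij}(n)$ and $g_{ji}(n)$ ($1\le i\le K$, $1\le j\le L$) are (circularly symmetric) complex Gaussian with mean zero and variances $E|f_{ij}(n)|^2=\sigma_f^2$, $E|g_{ji}(n)|^2=\sigma_g^2$. All these random variables are mutually independent, within each observation and across observations. The achievable rate at observation $n$ is $$R_n=\max_{1\le j\le L}\log_2\left(1+\frac{P_sP_r|f_{s(n)j}(n)|^2|g_{js(n)}(n)|^2}{1+P_s|f_{s(n)j}(n)|^2+P_r|g_{js(n)}(n)|^2}\right).$$ The reward and the time cost for stopping at observation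 $n$ are $Y_n=\frac T2R_n$ and $T_n=T+\tau\sum_{i=1}^nK_i$. A stopping rule is a stopping time $N$ with values in $\{1,2,\dots\}$ with respect to the filtration generated by the observed data $X(n)=(s(n),K_n,f_{s(n)1}(n),\dots,f_{s(n)L}(n),g_{1s(n)}(n),\dots,g_{Ls(n)}(n))$, with $E(T_N)<\infty$. *)

(* Defs.v *)
From HB Require Import structures.
From mathcomp Require Import all_boot all_order all_algebra.
From mathcomp Require Import all_classical all_reals all_analysis.
From mathcomp Require Export complex.

Set Implicit Arguments.
Unset Strict Implicit.
Unset Printing Implicit Defensive.

Import Order.TTheory GRing.Theory Num.Theory.

Local Open Scope classical_set_scope.
Local Open Scope ring_scope.

(* Observations are numbered 1, 2, ...; index 0 carries no meaning, and nothing
   is assumed about it.  The first source index i of [gainF n i j] and the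
   second of [gainG n j i] are the source-destination pair, j is the relay. *)
Record observations (R : realType) (K L : nat) (Omega : Type) := Observations {
  winner : nat -> Omega -> 'I_K ;
  slots : nat -> Omega -> nat ;
  gainF : nat -> 'I_K -> 'I_L -> Omega -> R[i] ;
  gainG : nat -> 'I_L -> 'I_K -> Omega -> R[i] }.

Definition reim (R : realType) (z : R[i]) : R * R := (complex.Re z, complex.Im z).

(* The sigma-algebra on Omega generated by X. *)
Definition sigma_of d (U : measurableType d) (Omega : Type) (X : Omega -> U) :
    set (set Omega) :=
  preimage_set_system setT X measurable.

(* One index for each basic random variable of the model. *)
Inductive rv_index (K L : nat) : Type :=
| Winner of nat
| Slots of nat
| GainF of nat & 'I_K & 'I_L
| GainG of nat & 'I_L & 'I_K.

Definition obs_of (K L : nat) (k : rv_index K L) : nat :=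
  match k with
  | Winner n | Slots n | GainF n _ _ | GainG n _ _ => n
  end.

(* The finite type 'I_K is read in nat, and R[i] in R * R, which carry the
   discrete and the Borel measurable structure, respectively. *)
Definition rv_sigma (R : realType) (K L : nat) (Omega : Type)
    (X : observations R K L Omega) (k : rv_index K L) : set (set Omega) :=
  match k with
  | Winner n => sigma_of (fun w => nat_of_ord (winner X n w))
  | Slots n => sigma_of (slots X n)
  | GainF n i j => sigma_of (fun w => reim (gainF X n i j w))
  | GainG n j i => sigma_of (fun w => reim (gainG X n j i w))
  end.

(* The set systems G i, i in D, are mutually independent: product rule over all
   finite subfamilies. *)
Definition mutually_independent d (Omega : measurableType d) (R : realType)
    (P : probability Omega R) (I : Type) (D : set I) (G : I -> set (set Omega)) :
    Prop :=
  forall (m : nat) (idx : 'I_m -> I) (E : 'I_m -> set Omega),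
    injective idx -> (forall a, D (idx a)) -> (forall a, G (idx a) (E a)) ->
    P (\bigcap_(a in [set: 'I_m]) E a) = (\prod_(a < m) P (E a))%E.

(* Circularly symmetric: the real and imaginary parts are independent centered
   real Gaussians, each of variance v / 2, so that E |Z|^2 = v.
   [normal_prob] takes the standard deviation. *)
Definition complex_gaussian d (Omega : measurableType d) (R : realType)
    (P : probability Omega R) (v : R) (Z : Omega -> R[i]) : Prop :=
  measurable_fun setT (fun w => reim (Z w)) /\
  forall B : set (R * R), measurable B ->
    P ((fun w => reim (Z w)) @^-1` B) =
    (normal_prob 0 (Num.sqrt (v / 2)) \x normal_prob 0 (Num.sqrt (v / 2)))%E B.

(* Success probability of one contention slot. *)
Definition success_prob (R : realType) (K : nat) (p0 : R) : R :=
  K%:R * p0 * (1 - p0) ^+ K.-1.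

Record channel_model (R : realType) (K L : nat) (sf2 sg2 p0 : R)
    d (Omega : measurableType d) (P : probability Omega R)
    (X : observations R K L Omega) : Prop := ChannelModel {
  winner_measurable : forall n, (0 < n)%N ->
    measurable_fun setT (fun w => nat_of_ord (winner X n w)) ;
  winner_uniform : forall n (i : 'I_K), (0 < n)%N ->
    P [set w | winner X n w = i] = (K%:R^-1)%:E ;
  slots_measurable : forall n, (0 < n)%N -> measurable_fun setT (slots X n) ;
  slots_geometric : forall n k, (0 < n)%N -> (0 < k)%N ->
    P [set w | slots X n w = k] =
    (success_prob K p0 * (1 - success_prob K p0) ^+ k.-1)%:E ;
  gainF_gaussian : forall n i j, (0 < n)%N ->
    complex_gaussian P sf2 (gainF X n i j) ;
  gainG_gaussian : forall n j i, (0 < n)%N ->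
    complex_gaussian P sg2 (gainG X n j i) ;
  rv_independent :
    mutually_independent P [set k | (0 < obs_of k)%N] (rv_sigma X) }.

Definition log2 (R : realType) (x : R) : R := ln x / ln 2.

Definition sqmod (R : realType) (z : R[i]) : R := ComplexField.Normc.normc z ^+ 2.

(* All the terms are nonnegative and L is positive, so the default value 0 of
   the iterated maximum is immaterial. *)
Definition rate (R : realType) (K L : nat) (Ps Pr : R) (Omega : Type)
    (X : observations R K L Omega) (n : nat) (w : Omega) : R :=
  let i := winner X n w in
  \big[Num.max/0]_(j < L)
    let a := sqmod (gainF X n i j w) in
    let b := sqmod (gainG X n j i w) in
    log2 (1 + Ps * Pr * a * b / (1 + Ps * a + Pr * b)).

Definition reward (R : realType) (K L : nat) (T Ps Pr : R) (Omega : Type)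
    (X : observations R K L Omega) (n : nat) (w : Omega) : R :=
  T / 2 * rate Ps Pr X n w.

Definition time_cost (R : realType) (K L : nat) (T tau : R) (Omega : Type)
    (X : observations R K L Omega) (n : nat) (w : Omega) : R :=
  T + tau * \sum_(1 <= i < n.+1) (slots X i w)%:R.

(* Generators of the sigma-algebra of the data X(n) seen at observation n: only
   the gains of the winning pair are observed. *)
Definition observed (R : realType) (K L : nat) (Omega : Type)
    (X : observations R K L Omega) (n : nat) : set (set Omega) :=
  sigma_of (fun w => nat_of_ord (winner X n w)) `|`
  sigma_of (slots X n) `|`
  \bigcup_(j in [set: 'I_L])
    sigma_of (fun w => reim (gainF X n (winner X n w) j w)) `|`
  \bigcup_(j in [set: 'I_L])
    sigma_of (fun w => reim (gainG X n j (winner X n w) w)).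

Definition filtration (R : realType) (K L : nat) (Omega : Type)
    (X : observations R K L Omega) (n : nat) : set (set Omega) :=
  <<s \bigcup_(m in [set m | (1 <= m <= n)%N]) observed X m >>.

(* A random time is a function to option nat; None means never stopping.  The
   value 0 given to a process when never stopping is immaterial, since stopping
   rules stop almost surely. *)
Definition stopped (R : realType) (Omega : Type) (Z : nat -> Omega -> R)
    (N : Omega -> option nat) (w : Omega) : R :=
  if N w is Some n then Z n w else 0.

Record stopping_rule (R : realType) (K L : nat) (T tau : R)
    d (Omega : measurableType d) (P : probability Omega R)
    (X : observations R K L Omega) (N : Omega -> option nat) : Prop :=
  StoppingRule {
  stopping_pos : forall w, N w <> Some 0%N ;
  stopping_adapted : forall n, (0 < n)%N ->
    filtration X n [set w | N w = Some n] ;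
  stopping_finite : P [set w | N w = None] = 0%E ;
  stopping_integrable : ('E_P[stopped (time_cost T tau X) N] < +oo)%E }.

Definition throughput (R : realType) (K L : nat) (T tau Ps Pr : R)
    d (Omega : measurableType d) (P : probability Omega R)
    (X : observations R K L Omega) (N : Omega -> option nat) : \bar R :=
  ('E_P[stopped (reward T Ps Pr X) N] / 'E_P[stopped (time_cost T tau X) N])%E.

Definition threshold_equation (R : realType) (K L : nat) (T tau Ps Pr p0 : R)
    d (Omega : measurableType d) (P : probability Omega R)
    (X : observations R K L Omega) (lam : R) : Prop :=
  forall n, (0 < n)%N ->
    ('E_P[fun w => Num.max (T / 2 * rate Ps Pr X n w - lam * T)%R 0%R] =
     (lam * tau / success_prob K p0)%:E)%E.

(* The least n >= 1 with p n, if any. *)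
Definition first_time (p : pred nat) : option nat :=
  match pselect (exists n, (0 < n)%N && p n) with
  | left h => Some (ex_minn h)
  | right _ => None
  end.

Definition threshold_rule (R : realType) (K L : nat) (Ps Pr : R) (Omega : Type)
    (X : observations R K L Omega) (lam : R) (w : Omega) : option nat :=
  first_time (fun n => 2 * lam <= rate Ps Pr X n w).

(* Main.v *)
(* Let U_n = max (T/2 R_n - lam T, 0) be the excess reward.  Whatever N is,
   Y_N <= lam T + U_N <= lam T + U_1 + ... + U_N, and both inequalities are
   equalities when N is the threshold rule, since R_n < 2 lam before N and
   R_N >= 2 lam.  The event N >= n depends on the first n - 1 observations only,
   hence is independent of U_n and K_n, and Wald's identity for nonnegative
   variables gives E (U_1 + ... + U_N) = E U_1 E N and E T_N = T + tau E N / p_s.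
   As E U_1 = lam tau / p_s, it follows that E Y_N <= lam E T_N, with equality
   for the threshold rule.  The map lam |-> E U_1 is finite (a Gaussian has a
   second moment), nonincreasing and Lipschitz, while lam tau / p_s increases
   from 0 to infinity, hence the equation for lam has exactly one solution. *)

From HB Require Import structures.
Require Import Defs.
From mathcomp Require Import all_boot all_order all_algebra.
From mathcomp Require Import all_classical all_reals all_analysis.
From mathcomp Require Import measurable_realfun ring lra.

Set Implicit Arguments.
Unset Strict Implicit.
Unset Printing Implicit Defensive.

Import Order.TTheory GRing.Theory Num.Theory.
Import numFieldNormedType.Exports.

Local Open Scope classical_set_scope.
Local Open Scope ring_scope.

(** * Independence of sigma-algebras generated by disjoint subfamilies *)

(** Independence is assumed only as a product rule over finitely many basic variables, whereas the
    event N >= n and U_n depend on whole groups of them; a pi-lambda argument carries the rule over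
    to the sigma-algebras generated by disjoint groups. The rate reads the gains of a randomly
    chosen pair, so the data of observation n are placed inside the sigma-algebra of all basic
    variables of index n, and the common law of the R_n is obtained by splitting over the winner.
    Only tails P(R_n > r) are compared, because the expectation of a nonnegative variable is the
    integral of its tail. The threshold rule must also be shown admissible: if lam > 0, the equation
    itself forces P(R_n > 2 lam) > 0, so the number of observations has a geometric tail and a
    finite mean. Expectations of nonnegative variables are taken in the extended reals, so Wald's
    identity needs no prior integrability and allows E N to be infinite. *)

Lemma g_sigma_sub_measurable d (T : measurableType d) (H : set (set T)) :
  H `<=` measurable -> <<s H >> `<=` measurable.
Proof. exact: (smallest_sub (@sigma_algebra_measurable _ T)). Qed.

Section independent_families.
Context d (Omega : measurableType d) (R : realType) (P : probability Omega R).
Context (I : choiceType) (D : set I) (G : I -> set (set Omega)).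
Hypotheses (Gm : forall k, D k -> G k `<=` measurable)
  (GT : forall k, G k setT) (GI : forall k, setI_closed (G k))
  (indepG : mutually_independent P D G).

Lemma mutually_independent_seq (s : seq I) (E : I -> set Omega) :
  uniq s -> (forall k, k \in s -> D k) -> (forall k, G k (E k)) ->
  P (\bigcap_(k in [set` s]) E k) = (\prod_(k <- s) P (E k))%E.
Proof.
move=> us sD GE.
rewrite big_tnth -(indepG (idx := tnth (in_tuple s)) (E := E \o tnth (in_tuple s))).
- congr (P _); apply/seteqP; split=> [w sw a _|w sw k /= ks].
    by apply: sw => /=; exact: mem_tnth.
  have /tnthP[a ->] : k \in in_tuple s by [].
  exact: sw.
- exact/tuple_uniqP.
- by move=> a; apply: sD; exact: (mem_tnth a (in_tuple s)).
- by move=> a; exact: GE.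
Qed.

(* The pi-system generating the sigma-algebra of the subfamily A. *)
Definition finite_caps (A : set I) : set (set Omega) :=
  [set S | exists (s : seq I) (E : I -> set Omega),
    [/\ uniq s, forall k, k \in s -> A k, forall k, G k (E k),
      forall k, k \notin s -> E k = setT & S = \bigcap_(k in [set` s]) E k]].

(** Since the sets are [setT] outside the support, two representations can be intersected index by
    index over the union of their supports. *)
Lemma finite_caps_setI A : setI_closed (finite_caps A).
Proof.
move=> _ _ [s [E [us sA GE ET ->]]] [s' [E' [us' s'A GE' ET' ->]]].
exists (undup (s ++ s')), (fun k => E k `&` E' k); split.
- exact: undup_uniq.
- by move=> k; rewrite mem_undup mem_cat => /orP[/sA|/s'A].
- by move=> k; exact: GI.
- move=> k; rewrite mem_undup mem_cat negb_or => /andP[ks ks'].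
  by rewrite ET// ET'// setIT.
apply/seteqP; split=> [w [sw s'w] k /= _|w sw].
  split; first by have [/sw//|/ET->//] := boolP (k \in s).
  by have [/s'w//|/ET'->//] := boolP (k \in s').
by split=> k /= ks; have [] := sw k; rewrite //= mem_undup mem_cat ks ?orbT.
Qed.

Lemma finite_caps_setT A : finite_caps A setT.
Proof.
by exists [::], (fun=> setT); split=> //; rewrite set_nil bigcap_set0.
Qed.

Lemma finite_caps_measurable A : A `<=` D -> finite_caps A `<=` measurable.
Proof.
move=> AD _ [s [E [us sA GE ET ->]]].
rewrite bigcap_seq big_seq; apply: (big_ind measurable) => //.
- by move=> *; exact: measurableI.
- by move=> k /sA /AD Dk; exact: (Gm Dk).
Qed.

Lemma bigcup_sub_finite_caps A : \bigcup_(k in A) G k `<=` finite_caps A.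
Proof.
move=> S [k Ak GS]; exists [:: k], (fun l => if l == k then S else setT); split=> //.
- by move=> l; rewrite inE => /eqP ->.
- by move=> l; case: eqP => [->|].
- by move=> l; rewrite inE => /negbTE ->.
- by rewrite bigcap_seq big_seq1 eqxx.
Qed.

Lemma indep_finite_caps A B S S' : A `<=` D -> B `<=` D -> A `&` B = set0 ->
  finite_caps A S -> finite_caps B S' -> P (S `&` S') = (P S * P S')%E.
Proof.
move=> AD BD AB0 [s [E [us sA GE ET ->]]] [s' [E' [us' s'B GE' ET' ->]]].
have ss' k : k \in s -> k \notin s'.
  move=> /sA Ak; apply/negP => /s'B Bk.
  by have : (A `&` B) k by []; rewrite AB0.
(* The supports are disjoint, so one family carries both and the product rule applies to the
   concatenation of the lists. *)
pose F k := if k \in s then E k else E' k.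
rewrite (_ : _ `&` _ = \bigcap_(k in [set` s ++ s']) F k); last first.
  rewrite /F; apply/seteqP; split=> [w [sw s'w] k /=|w sw].
    by rewrite mem_cat; case: ifPn => [/sw//|_ /= /s'w].
  split=> k /= ks.
    by have := sw k; rewrite /= mem_cat ks; exact.
  have := sw k; rewrite /= mem_cat ks orbT ifN; first exact.
  by apply: contraL ks; exact: ss'.
rewrite !mutually_independent_seq//.
- rewrite big_cat/=; congr (_ * _)%E; apply: eq_big_seq => k ks.
    by rewrite /F ks.
  by rewrite /F ifN//; apply: contraL ks; exact: ss'.
- by move=> k /s'B /BD.
- by move=> k /sA /AD.
- rewrite cat_uniq us us' andbT/=; apply/hasPn => k ks'.
  by apply: contraL ks'; exact: ss'.
- by move=> k; rewrite mem_cat => /orP[/sA/AD|/s'B/BD].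
- by move=> k; rewrite /F; case: ifP.
Qed.

(** Both S |-> P (S [&] F) and S |-> P S * P F are finite measures, a restriction and a rescaling of
    P. They agree on a pi-system containing [setT], hence on the sigma-algebra it generates. *)
Lemma indep_extend (H : set (set Omega)) (F : set Omega) :
  H `<=` measurable -> setI_closed H -> H setT -> measurable F ->
  (forall S, H S -> P (S `&` F) = (P S * P F)%E) ->
  forall S, <<s H >> S -> P (S `&` F) = (P S * P F)%E.
Proof.
move=> Hm HI HT mF HP S HS.
have PF0 : 0 <= fine (P F) by rewrite fine_ge0.
have PFE : (fine (P F))%:E = P F by rewrite fineK// fin_num_measure.
have mscaleE A : mscale (NngNum PF0) P A = (P A * P F)%E.
  by rewrite /mscale /= PFE muleC.
rewrite -mscaleE -[LHS]/(mrestr P mF S).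
apply: (g_sigma_algebra_measure_unique H Hm (fun=> setT)) => //.
- by apply: bigcup_const; exists 0%N.
- by move=> A HA; rewrite [RHS]mscaleE -HP.
- move=> _; rewrite /= /mrestr setTI (le_lt_trans (probability_le1 P mF))//.
  by rewrite ltry.
Qed.

(** The extension is made one argument at a time: with [S'] fixed, [S] is reduced to a finite
    intersection, which is then held fixed while [S'] is reduced in turn. *)
Lemma indep_grouping A B S S' : A `<=` D -> B `<=` D -> A `&` B = set0 ->
  <<s \bigcup_(k in A) G k >> S -> <<s \bigcup_(k in B) G k >> S' ->
  P (S `&` S') = (P S * P S')%E.
Proof.
move=> AD BD AB0 AS BS'.
have caps C : <<s \bigcup_(k in C) G k >> `<=` <<s finite_caps C >>.
  by apply: sub_sigma_algebra2; exact: bigcup_sub_finite_caps.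
have /g_sigma_sub_measurable mB := finite_caps_measurable BD.
apply: (indep_extend _ _ _ _ _ (caps _ _ AS)) => //.
- exact: finite_caps_measurable.
- exact: finite_caps_setI.
- exact: finite_caps_setT.
- exact: (mB _ (caps _ _ BS')).
move=> T AT; rewrite setIC muleC.
apply: (indep_extend _ _ _ _ _ (caps _ _ BS')) => //.
- exact: finite_caps_measurable.
- exact: finite_caps_setI.
- exact: finite_caps_setT.
- exact: finite_caps_measurable AT.
- by move=> T' BT'; rewrite setIC muleC; apply: indep_finite_caps AT BT'.
Qed.

End independent_families.

(** * Expectations of nonnegative variables through their tails *)

Section nonnegative_expectations.
Context d (Omega : measurableType d) (R : realType) (P : probability Omega R).

(** Turns a comparison of expectations into one of the probabilities of half-lines, the only part of
    the law of the rate that is computed below. *)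
Lemma ge0_expectation_tail (U : Omega -> R) :
  measurable_fun setT U -> (forall w, 0 <= U w) ->
  ('E_P[U] =
   \int[lebesgue_measure]_(r in `[0%R, +oo[) P [set w | (r < U w)%R])%E.
Proof.
move=> mU U0; pose mU' := isMeasurableFun.Build _ _ _ _ _ mU.
pose V : {mfun Omega >-> R} := HB.pack U mU'.
rewrite (ge0_expectation_ccdf (X := V : {RV P >-> R}))//.
apply: eq_integral => r _; congr (P _); apply/seteqP.
by split=> w /=; rewrite in_itv/= andbT.
Qed.

Lemma measurable_fun_g_sigma d' (T : measurableType d') (H : set (set Omega))
    (U : Omega -> T) : H `<=` measurable ->
  measurable_fun setT (U : g_sigma_algebraType H -> T) -> measurable_fun setT U.
Proof.
move=> Hm mU _ B mB; apply: (g_sigma_sub_measurable Hm).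
exact: (mU measurableT B mB).
Qed.

(** For [r >= 0] the product exceeds r exactly on {U > r} [&] A, whose probability factors by
    [indA]; integrating over r pulls out the constant P A. *)
Lemma indep_expectation (H : set (set Omega)) (U : Omega -> R) (A : set Omega) :
  H `<=` measurable -> measurable_fun setT (U : g_sigma_algebraType H -> R) ->
  (forall w, 0 <= U w) -> measurable A ->
  (forall S, <<s H >> S -> P (S `&` A) = (P S * P A)%E) ->
  ('E_P[fun w => (U w * \1_A w)%R] = 'E_P[U] * P A)%E.
Proof.
move=> Hm mU U0 mA indA; have mUO := measurable_fun_g_sigma Hm mU.
rewrite !ge0_expectation_tail//; first last.
- by move=> w; rewrite mulr_ge0// indicE.
- by apply: measurable_funM => //; exact: measurable_indic.
have mS (r : R) : <<s H >> [set w | r < U w].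
  have := mU measurableT `]r, +oo[%classic (measurable_itv _).
  rewrite setTI; congr (<<s H >> _).
  by apply/seteqP; split=> w /=; rewrite in_itv/= andbT.
have PAE : P A = (fine (P A))%:E by rewrite fineK// fin_num_measure.
rewrite muleC PAE -ge0_integralZl_EFin//; last by rewrite fine_ge0.
  apply: eq_integral => r; rewrite inE/= in_itv/= andbT => r0.
  rewrite -PAE muleC -indA//; congr (P _); apply/seteqP; split=> w /=.
    rewrite indicE; case: (boolP (w \in A)) => [|_].
      by rewrite inE mulr1.
    by rewrite mulr0 => /(le_lt_trans r0); rewrite ltxx.
  by move=> [rU Aw]; rewrite indicE mem_set// mulr1.
pose mU' := isMeasurableFun.Build _ _ _ _ _ mUO.
pose V : {mfun Omega >-> R} := HB.pack U mU'.
apply: measurable_funTS.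
rewrite (_ : (fun r : R => _) = ccdf (V : {RV P >-> R})).
  exact: ccdf_measurable.
apply/funext => r; congr (P _).
by apply/seteqP; split=> w /=; rewrite in_itv/= andbT.
Qed.

End nonnegative_expectations.

Lemma sigma_of_measurable_fun d d' (U : measurableType d) (Omega : measurableType d')
    (H : set (set Omega)) (X : Omega -> U) :
  sigma_of X `<=` H -> measurable_fun setT (X : g_sigma_algebraType H -> U).
Proof.
move=> XH _ B mB; apply: sub_sigma_algebra; apply: XH.
by exists B.
Qed.

Lemma measurable_bigmax d (T : measurableType d) (R : realType) (I : Type)
    (s : seq I) (F : I -> T -> R) : (forall i, measurable_fun setT (F i)) ->
  measurable_fun setT (fun w => \big[Num.max/0]_(i <- s) F i w).
Proof.
move=> mF; elim: s => [|i s IHs].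
  by under eq_fun do rewrite big_nil; exact: measurable_cst.
by under eq_fun do rewrite big_cons; exact: measurable_maxr.
Qed.

(** * The rate of one pair through one relay *)

Section pair_rate.
Context (R : realType) (Ps Pr : R).
Hypotheses (hPs : 0 < Ps) (hPr : 0 < Pr).

Definition sqnorm (z : R * R) : R := z.1 ^+ 2 + z.2 ^+ 2.

Lemma sqnorm_ge0 z : 0 <= sqnorm z.
Proof. by rewrite addr_ge0// sqr_ge0. Qed.

Lemma sqmodE (z : R[i]) : sqmod z = sqnorm (reim z).
Proof. by case: z => a b; rewrite /sqmod /sqnorm/= sqr_sqrtr// addr_ge0// sqr_ge0. Qed.

Lemma measurable_sqnorm : measurable_fun setT sqnorm.
Proof.
by apply: measurable_funD; apply: measurable_funX;
  [exact: measurable_fst|exact: measurable_snd].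
Qed.

Definition pair_rate (z : (R * R) * (R * R)) : R :=
  let a := sqnorm z.1 in let b := sqnorm z.2 in
  log2 (1 + Ps * Pr * a * b / (1 + Ps * a + Pr * b)).

Let den_gt0 (a b : R) : 0 <= a -> 0 <= b -> 0 < 1 + Ps * a + Pr * b.
Proof.
move=> a0 b0; rewrite -addrA ltr_wpDr// addr_ge0// mulr_ge0// ltW//.
Qed.

(* Avoids the measurability of the inverse. *)
Let pair_rateE z : pair_rate z =
  (ln ((1 + Ps * sqnorm z.1) * (1 + Pr * sqnorm z.2)) -
   ln (1 + Ps * sqnorm z.1 + Pr * sqnorm z.2)) * (ln 2)^-1.
Proof.
rewrite /pair_rate /log2; congr (_ * _).
have := sqnorm_ge0 z.1; have := sqnorm_ge0 z.2.
move: (sqnorm z.1) (sqnorm z.2) => a b b0 a0.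
have d0 := den_gt0 a0 b0.
have pos (c u : R) : 0 < c -> 0 <= u -> 0 < 1 + c * u.
  by move=> c0 u0; rewrite ltr_wpDr// mulr_ge0// ltW.
rewrite -ln_div ?posrE ?mulr_gt0 ?pos//; congr ln.
by apply: (mulIf (lt0r_neq0 d0)); rewrite mulrDl mul1r !divfK ?lt0r_neq0//; ring.
Qed.

Lemma measurable_pair_rate : measurable_fun setT pair_rate.
Proof.
have ma : measurable_fun setT (fun z : (R * R) * (R * R) => sqnorm z.1).
  by apply: (measurableT_comp measurable_sqnorm); exact: measurable_fst.
have mb : measurable_fun setT (fun z : (R * R) * (R * R) => sqnorm z.2).
  by apply: (measurableT_comp measurable_sqnorm); exact: measurable_snd.
rewrite (funext pair_rateE); apply: measurable_funM => //.
have mPa : measurable_fun setT (fun z : (R * R) * (R * R) => 1 + Ps * sqnorm z.1).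
  by apply: measurable_funD => //; exact: measurable_funM.
have mPb : measurable_fun setT (fun z : (R * R) * (R * R) => Pr * sqnorm z.2).
  exact: measurable_funM.
apply: measurable_funB; apply: (measurableT_comp (@measurable_ln R)).
  by apply: measurable_funM => //; apply: measurable_funD.
exact: measurable_funD.
Qed.

(** By ln (1 + x) <= x, and because the fraction is at most Pr b, as Ps a is one of the summands of
    its denominator. A second moment of the relay gain alone will therefore bound the expected
    rate. *)
Lemma pair_rate_le z : pair_rate z <= Pr * sqnorm z.2 / ln 2.
Proof.
rewrite /pair_rate /log2 ler_pM2r ?invr_gt0 ?ln_gt0 ?ltr1n//.
have := sqnorm_ge0 z.1; have := sqnorm_ge0 z.2.
move: (sqnorm z.1) (sqnorm z.2) => a b b0 a0.
have d0 := den_gt0 a0 b0.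
have q0 : 0 <= Ps * Pr * a * b / (1 + Ps * a + Pr * b).
  by rewrite divr_ge0 ?mulr_ge0// ?(ltW hPs) ?(ltW hPr)// ltW.
rewrite (le_trans (le_ln1Dx _))//; first by rewrite (lt_le_trans _ q0)// ltrN10.
rewrite ler_pdivrMr//.
rewrite -subr_ge0 (_ : _ - _ = Pr * b * (1 + Pr * b)); last by ring.
by rewrite !(mulr_ge0, addr_ge0)// ltW.
Qed.

Lemma rateE (K L : nat) (Omega : Type) (X : observations R K L Omega) n w :
  rate Ps Pr X n w = \big[Num.max/0]_(j < L)
    pair_rate (reim (gainF X n (winner X n w) j w), reim (gainG X n j (winner X n w) w)).
Proof. by rewrite /rate; under eq_bigr do rewrite !sqmodE. Qed.

Lemma rate_ge0 (K L : nat) (Omega : Type) (X : observations R K L Omega) n w :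
  0 <= rate Ps Pr X n w.
Proof. by rewrite rateE bigmax_idl le_max lexx. Qed.

End pair_rate.

(** By independence both joint laws are product measures, and a product measure is determined by its
    values on rectangles. *)
Lemma indep_pair_eq_law d (Omega : measurableType d) (R : realType)
    (P : probability Omega R) d1 d2 (T1 : measurableType d1)
    (T2 : measurableType d2) (f f' : Omega -> T1) (g g' : Omega -> T2) :
  measurable_fun setT f -> measurable_fun setT g ->
  measurable_fun setT f' -> measurable_fun setT g' ->
  (forall A, measurable A -> P (f @^-1` A) = P (f' @^-1` A)) ->
  (forall B, measurable B -> P (g @^-1` B) = P (g' @^-1` B)) ->
  (forall A B, measurable A -> measurable B ->
    P (f @^-1` A `&` g @^-1` B) = (P (f @^-1` A) * P (g @^-1` B))%E) ->
  (forall A B, measurable A -> measurable B ->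
    P (f' @^-1` A `&` g' @^-1` B) = (P (f' @^-1` A) * P (g' @^-1` B))%E) ->
  forall C, measurable C ->
  P ((fun w => (f w, g w)) @^-1` C) = P ((fun w => (f' w, g' w)) @^-1` C).
Proof.
move=> mf mg mf' mg' ff' gg' fg_indep fg'_indep C mC.
pose rvf : {mfun Omega >-> T1} :=
  HB.pack f (isMeasurableFun.Build _ _ _ _ _ mf).
pose rvg : {mfun Omega >-> T2} :=
  HB.pack g (isMeasurableFun.Build _ _ _ _ _ mg).
pose rvfg : {mfun Omega >-> (T1 * T2)%type} :=
  HB.pack (fun w => (f w, g w))
    (isMeasurableFun.Build _ _ _ _ _ (measurable_fun_pair mf mg)).
pose rvfg' : {mfun Omega >-> (T1 * T2)%type} :=
  HB.pack (fun w => (f' w, g' w))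
    (isMeasurableFun.Build _ _ _ _ _ (measurable_fun_pair mf' mg')).
pose law := @product_measure_unique _ _ _ _ _
  (distribution P rvf) (distribution P rvg).
rewrite -[LHS]/(distribution P rvfg C) -[RHS]/(distribution P rvfg' C).
rewrite -(law (distribution P rvfg))// -(law (distribution P rvfg'))// => A B mA mB.
by rewrite -[LHS]/(P (f' @^-1` A `&` g' @^-1` B)) fg'_indep// -ff'// -gg'.
Qed.

(** * The law of the rate *)

HB.instance Definition _ (K L : nat) := gen_eqMixin (rv_index K L).
HB.instance Definition _ (K L : nat) := gen_choiceMixin (rv_index K L).

Section channel.
Context (R : realType) (K L : nat) (sf2 sg2 p0 : R).
Context d (Omega : measurableType d) (P : probability Omega R).
Context (X : observations R K L Omega).
Hypothesis hX : channel_model sf2 sg2 p0 P X.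

Local Notation rv_gen A := (\bigcup_(k in A) rv_sigma X k).
Local Notation later_than0 := [set k : rv_index K L | (0 < obs_of k)%N].

Lemma sigma_of_sub_measurable d' (U : measurableType d') (Y : Omega -> U) :
  measurable_fun setT Y -> sigma_of Y `<=` measurable.
Proof. by move=> mY _ [B mB <-]; exact: mY. Qed.

Lemma sigma_of_setT d' (U : measurableType d') (Y : Omega -> U) : sigma_of Y setT.
Proof. by exists setT => //; rewrite preimage_setT setTI. Qed.

Lemma sigma_of_setI d' (U : measurableType d') (Y : Omega -> U) :
  setI_closed (sigma_of Y).
Proof.
move=> _ _ [B mB <-] [C mC <-]; exists (B `&` C); first exact: measurableI.
by rewrite preimage_setI !setTI.
Qed.

Lemma rv_sigma_setT k : rv_sigma X k setT.
Proof. by case: k => *; exact: sigma_of_setT. Qed.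

Lemma rv_sigma_setI k : setI_closed (rv_sigma X k).
Proof. by case: k => *; exact: sigma_of_setI. Qed.

Lemma rv_sigma_measurable k : (0 < obs_of k)%N -> rv_sigma X k `<=` measurable.
Proof.
case: k => [n|n|n i j|n j i] /= n0; apply: sigma_of_sub_measurable.
- exact: (winner_measurable hX).
- exact: (slots_measurable hX).
- exact: (gainF_gaussian hX i j n0).1.
- exact: (gainG_gaussian hX j i n0).1.
Qed.

Lemma rv_gen_measurable A : A `<=` later_than0 -> rv_gen A `<=` measurable.
Proof. by move=> A0 S [k /A0 k0]; exact: rv_sigma_measurable. Qed.

Lemma rv_gen_indep A B S S' : A `<=` later_than0 -> B `<=` later_than0 ->
  A `&` B = set0 -> <<s rv_gen A >> S -> <<s rv_gen B >> S' ->
  P (S `&` S') = (P S * P S')%E.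
Proof.
exact: (indep_grouping rv_sigma_measurable rv_sigma_setT rv_sigma_setI
  (rv_independent hX)).
Qed.

Lemma rv_gen_measurable_fun d' (U : measurableType d') (Y : Omega -> U) A k :
  A k -> sigma_of Y = rv_sigma X k ->
  measurable_fun setT (Y : g_sigma_algebraType (rv_gen A) -> U).
Proof.
by move=> Ak Yk; apply: sigma_of_measurable_fun => S; rewrite Yk; exists k.
Qed.

(** The random index takes finitely many values; on each event {winner = i} the function coincides
    with [Y i]. *)
Lemma measurable_at_winner d' (U : measurableType d') n (A : set (rv_index K L))
    (Y : 'I_K -> Omega -> U) : A (Winner K L n) ->
  (forall i, measurable_fun setT (Y i : g_sigma_algebraType (rv_gen A) -> U)) ->
  measurable_fun setT
    ((fun w => Y (winner X n w) w) : g_sigma_algebraType (rv_gen A) -> U).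
Proof.
move=> An mY _ B mB; rewrite setTI.
rewrite (_ : _ @^-1` B = \bigcup_(i in [set: 'I_K])
    ([set w | nat_of_ord (winner X n w) = i] `&` Y i @^-1` B)).
  apply: fin_bigcup_measurable => // i _; apply: measurableI.
    have mW := rv_gen_measurable_fun (k := Winner K L n)
      (Y := fun w => nat_of_ord (winner X n w)) An erefl.
    by have := mW measurableT [set nat_of_ord i] I; rewrite setTI.
  by have := mY i measurableT B mB; rewrite setTI.
apply/seteqP; split=> [w /= YB|w [i _ /= [wi]]]; first by exists (winner X n w).
by have -> : i = winner X n w by exact: val_inj.
Qed.

(** The generators on the right include the gains of the losing pairs. This larger sigma-algebra is
    described by indices alone, so independence across observations reduces to disjointness of index
    sets. *)
Lemma observed_sub n : observed X n `<=` <<s rv_gen [set k | obs_of k = n] >>.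
Proof.
pose H := rv_gen [set k | obs_of k = n].
have rv k : obs_of k = n -> rv_sigma X k `<=` <<s H >>.
  by move=> kn S kS; apply: sub_sigma_algebra; exists k.
move=> S [[[|]|[j _]]|[j _]].
- exact: (rv (Winner K L n)).
- exact: (rv (Slots K L n)).
- move=> [B mB <-].
  apply: (measurable_at_winner (A := [set k | obs_of k = n]) (n := n)
    (Y := fun i w => reim (gainF X n i j w))) => // i.
  exact: (rv_gen_measurable_fun (k := GainF n i j)).
- move=> [B mB <-].
  apply: (measurable_at_winner (A := [set k | obs_of k = n]) (n := n)
    (Y := fun i w => reim (gainG X n j i w))) => // i.
  exact: (rv_gen_measurable_fun (k := GainG n j i)).
Qed.

Lemma filtration_sub n :
  filtration X n `<=` <<s rv_gen [set k | (0 < obs_of k <= n)%N] >>.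
Proof.
apply: smallest_sub; first exact: smallest_sigma_algebra.
move=> S [m /= mn] /observed_sub; apply: sub_sigma_algebra2 => T [k /= km kT].
by exists k; rewrite /= ?km.
Qed.

Lemma filtration_measurable n : filtration X n `<=` measurable.
Proof.
apply: (subset_trans (filtration_sub (n := n))); apply: g_sigma_sub_measurable.
by apply: rv_gen_measurable => k /= /andP[].
Qed.

Section rate.
Context (Ps Pr : R).
Hypotheses (hPs : 0 < Ps) (hPr : 0 < Pr).

(** Measurability for the data actually seen is what makes the threshold rule adapted; the version
    for all variables of the observation, used for independence, follows from it. *)
Lemma measurable_rate_observed n : measurable_fun setT
  (rate Ps Pr X n : g_sigma_algebraType (observed X n) -> R).
Proof.
rewrite (funext (rateE Ps Pr X n)).
apply: measurable_bigmax => j.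
apply: (measurableT_comp (measurable_pair_rate hPs hPr)).
apply: measurable_fun_pair; apply: sigma_of_measurable_fun => S XS.
  by left; right; exists j.
by right; exists j.
Qed.

Lemma measurable_rate_filtration m n : (0 < m <= n)%N -> forall B : set R,
  measurable B -> filtration X n (rate Ps Pr X m @^-1` B).
Proof.
move=> mn B mB.
have := measurable_rate_observed (n := m) measurableT mB; rewrite setTI.
by apply: sub_sigma_algebra2 => S mS; exists m.
Qed.

Lemma measurable_rate_gen n : measurable_fun setT (rate Ps Pr X n :
  g_sigma_algebraType (rv_gen [set k | obs_of k = n]) -> R).
Proof.
move=> _ B mB.
have := measurable_rate_observed (n := n) measurableT mB.
apply: smallest_sub; first exact: smallest_sigma_algebra.
exact: observed_sub.
Qed.

Lemma measurable_rate n : (0 < n)%N -> measurable_fun setT (rate Ps Pr X n).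
Proof.
move=> n0; apply: measurable_fun_g_sigma (@measurable_rate_gen n).
by apply: rv_gen_measurable => k /= ->.
Qed.

End rate.

Section law_of_rate.
Context (Ps Pr : R).
Hypotheses (hPs : 0 < Ps) (hPr : 0 < Pr).

Local Notation V n i j :=
  (fun w => pair_rate Ps Pr (reim (gainF X n i j w), reim (gainG X n j i w))).

Lemma pair_rate_eq_law n i j (B : set R) : (0 < n)%N -> measurable B ->
  P (V n i j @^-1` B) = P (V 1 i j @^-1` B).
Proof.
move=> n0 mB.
have indep m : (0 < m)%N -> forall A C, measurable A -> measurable C ->
    P ((fun w => reim (gainF X m i j w)) @^-1` A `&`
       (fun w => reim (gainG X m j i w)) @^-1` C) =
    (P ((fun w => reim (gainF X m i j w)) @^-1` A) *
     P ((fun w => reim (gainG X m j i w)) @^-1` C))%E.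
  move=> m0 A C mA mC.
  apply: (rv_gen_indep (A := [set GainF m i j]) (B := [set GainG m j i])).
  - by move=> _ ->.
  - by move=> _ ->.
  - by apply/seteqP; split=> // k /= [->].
  - by rewrite bigcup_set1; apply: sub_sigma_algebra; exists A; rewrite ?setTI.
  - by rewrite bigcup_set1; apply: sub_sigma_algebra; exists C; rewrite ?setTI.
have [mF lF] := gainF_gaussian hX i j n0.
have [mG lG] := gainG_gaussian hX j i n0.
have [mF1 lF1] := gainF_gaussian hX i j (ltn0Sn 0).
have [mG1 lG1] := gainG_gaussian hX j i (ltn0Sn 0).
have mC : measurable (pair_rate Ps Pr @^-1` B).
  by have := measurable_pair_rate hPs hPr measurableT mB; rewrite setTI.
apply: (indep_pair_eq_law mF mG mF1 mG1 _ _ _ _ mC).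
- by move=> A mA; rewrite lF// lF1.
- by move=> A mA; rewrite lG// lG1.
- exact: indep.
- exact: indep.
Qed.

Lemma measurable_pair_rate_gen n i j A (r : R) :
  A (GainF n i j) -> A (GainG n j i) ->
  <<s rv_gen A >> [set w | V n i j w <= r].
Proof.
move=> AF AG.
have mV : measurable_fun setT (V n i j : g_sigma_algebraType (rv_gen A) -> R).
  apply: (measurableT_comp (measurable_pair_rate hPs hPr)).
  apply: measurable_fun_pair.
    exact: (rv_gen_measurable_fun (k := GainF n i j)).
  exact: (rv_gen_measurable_fun (k := GainG n j i)).
have := mV measurableT `]-oo, r]%classic (measurable_itv _).
by rewrite setTI.
Qed.

(** Induction on the list of relays: as [j] does not recur in the tail, its two gains are
    independent of those of the remaining relays. The factors on the right refer to observation 1,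
    so they are free of n. *)
Lemma pair_rates_le n i (r : R) (s : seq 'I_L) : (0 < n)%N -> uniq s ->
  P [set w | forall j, j \in s -> V n i j w <= r] =
  (\prod_(j <- s) P [set w | (V 1 i j w <= r)%R])%E.
Proof.
move=> n0; elim: s => [_|j s IHs /= /andP[js us]].
  by rewrite big_nil (_ : mkset _ = setT) ?probability_setT//; apply/seteqP.
rewrite big_cons -IHs//.
have -> : P [set w | V 1 i j w <= r] = P [set w | V n i j w <= r].
  exact/esym/(pair_rate_eq_law i j n0 (measurable_itv `]-oo, r])).
pose B := [set k | exists2 j', j' \in s & k = GainF n i j' \/ k = GainG n j' i].
rewrite (_ : mkset _ = [set w | V n i j w <= r] `&`
    [set w | forall j, j \in s -> V n i j w <= r]); last first.
  apply/seteqP; split=> [w sw|w [jw sw] j'].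
    split; first by apply: sw; rewrite mem_head.
    by move=> j' j's; apply: sw; rewrite inE j's orbT.
  by rewrite inE => /orP[/eqP->|/sw].
apply: (rv_gen_indep (A := [set GainF n i j; GainG n j i]) (B := B)).
- by move=> k [->|->].
- by move=> k [j' _ [->|->]].
- apply/seteqP; split=> // k [kA [j' j's kB]].
  by case: kA kB => -> [] // [jj']; move: js; rewrite jj' j's.
- by apply: measurable_pair_rate_gen; [left|right].
- rewrite (_ : mkset _ = \bigcap_(j' in [set` s]) [set w | V n i j' w <= r])//.
  pose T := g_sigma_algebraType (rv_gen B).
  apply: (@fin_bigcap_measurable _ T) => // j' j's.
  by apply: measurable_pair_rate_gen; exists j' => //; [left|right].
Qed.

(** Given that i wins, the rate is the maximum of the [V n i j], and the winner is independent of
    the gains. The point of the formula is that its right-hand side does not mention n. *)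
Lemma rate_le_law n (r : R) : (0 < n)%N -> 0 <= r ->
  P [set w | rate Ps Pr X n w <= r] =
  (\sum_(i < K) ((K%:R^-1)%:E * \prod_(j < L) P [set w | (V 1 i j w <= r)%R]))%E.
Proof.
move=> n0 r0.
pose S i := [set w | winner X n w = i] `&`
  [set w | forall j, j \in index_enum 'I_L -> V n i j w <= r].
pose Gi (i : 'I_K) := [set k : rv_index K L | exists j, k = GainF n i j \/ k = GainG n j i].
have mSl i A : A (Winner K L n) -> <<s rv_gen A >> [set w | winner X n w = i].
  move=> AW; apply: sub_sigma_algebra; exists (Winner K L n) => //.
  exists [set nat_of_ord i] => //; rewrite setTI.
  by apply/seteqP; split=> w /= => [/val_inj|->].
have mSr i (A : set (rv_index K L)) : Gi i `<=` A ->
    <<s rv_gen A >> [set w | forall j, j \in index_enum 'I_L -> V n i j w <= r].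
  move=> GA; rewrite (_ : mkset _ =
    \bigcap_(j in [set` index_enum 'I_L]) [set w | V n i j w <= r])//.
  pose T := g_sigma_algebraType (rv_gen A).
  apply: (@fin_bigcap_measurable _ T) => // j _.
  by apply: measurable_pair_rate_gen; apply: GA; exists j; [left|right].
have mS i : measurable (S i).
  pose A := [set k : rv_index K L | obs_of k = n].
  apply: (@g_sigma_sub_measurable _ _ (rv_gen A)).
    by apply: rv_gen_measurable => k /= ->.
  apply: (@measurableI _ (g_sigma_algebraType (rv_gen A))); first exact: mSl.
  by apply: mSr => k [j [->|->]].
rewrite (_ : mkset _ = \bigcup_(i in [set: 'I_K]) S i); last first.
  apply/seteqP; split=> [w|w [i _ [<- /= Vw]]].
    rewrite /= rateE => /bigmax_leP[_ Vw]; exists (winner X n w) => //.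
    by split=> // j _; exact: Vw.
  (* Here [0 <= r] accounts for the default value [0] of the iterated maximum. *)
  by rewrite rateE; apply/bigmax_leP; split=> // j _; apply: Vw; exact: mem_index_enum.
have trivS : trivIset [set: 'I_K] S.
  by move=> i i' _ _ [w [[<- _] [<- _]]].
rewrite measure_fin_bigcup//; last exact: finite_finset.
rewrite (_ : [set: 'I_K] = [set` index_enum 'I_K]); last first.
  by apply/seteqP; split=> // i _; exact: mem_index_enum.
rewrite -(fsbig_seq _ _ (index_enum_uniq 'I_K)); apply: eq_bigr => i _.
rewrite -(winner_uniform hX i n0) -(pair_rates_le i r n0 (index_enum_uniq _)).
apply: (rv_gen_indep (A := [set Winner K L n]) (B := Gi i)).
- by move=> _ ->.
- by move=> k [j [->|->]].
- by apply/seteqP; split=> // k [-> [j []]].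
- exact: mSl.
- exact: mSr.
Qed.

Lemma rate_tail_law n (r : R) : (0 < n)%N ->
  P [set w | r < rate Ps Pr X n w] = P [set w | r < rate Ps Pr X 1 w].
Proof.
move=> n0; have [r0|r0] := leP 0 r; last first.
  by congr (P _); apply/seteqP; split=> w _ /=; rewrite (lt_le_trans r0)// rate_ge0.
have mle m : (0 < m)%N -> measurable [set w | rate Ps Pr X m w <= r].
  move=> m0; have := measurable_rate hPs hPr m0 measurableT (measurable_itv `]-oo, r]).
  by rewrite setTI.
have gtE m : [set w | r < rate Ps Pr X m w] = ~` [set w | rate Ps Pr X m w <= r].
  by apply/seteqP; split=> w /=; rewrite ltNge => /negP.
rewrite !gtE (probability_setC _ (mle _ n0)) (probability_setC _ (mle 1%N isT)).
by rewrite rate_le_law// rate_le_law.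
Qed.

End law_of_rate.

End channel.

(** * Moments *)

(** The tail of Y^2 is dominated by [C * expR (- u * r)], a multiple of an exponential density,
    whose integral over r is finite. *)
Lemma normal_second_moment_lty d (Omega : measurableType d) (R : realType)
    (P : probability Omega R) (s : R) (Y : Omega -> R) : s != 0 ->
  measurable_fun setT Y ->
  (forall A, measurable A -> P (Y @^-1` A) = normal_prob 0 s A) ->
  ('E_P[fun w => (Y w ^+ 2)%R] < +oo)%E.
Proof.
move=> s0 mY lawY.
have s2_gt0 : 0 < s ^+ 2 by rewrite exprn_even_gt0.
(* The Gaussian exponent x^2 / (2 s^2) equals 2 u x^2, and u x^2 is the exponent for deviation [s'];
   [C] below exchanges the normalizing constants. *)
pose u := (4 * s ^+ 2)^-1.
have u0 : 0 < u by rewrite invr_gt0 mulr_gt0.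
pose s' := s * Num.sqrt 2.
have s'0 : s' != 0 by rewrite mulf_neq0// sqrtr_eq0 -ltNge.
pose C := normal_peak s / normal_peak s'.
have C0 : 0 <= C by rewrite divr_ge0// normal_peak_ge0.
(* Chernoff: half of the exponent pays for the tail, the other half is the
   density of a normal law of doubled variance. *)
have pdf_le r x : r < x ^+ 2 ->
    normal_pdf 0 s x <= C * expR (- u * r) * normal_pdf 0 s' x.
  move=> rx; rewrite !normal_pdfE// /normal_fun !subr0.
  rewrite (_ : C * _ * _ = normal_peak s *
      (expR (- u * r) * expR (- x ^+ 2 / (s' ^+ 2 *+ 2)))); last first.
    by rewrite /C; field; rewrite gt_eqF// normal_peak_gt0.
  rewrite ler_wpM2l ?normal_peak_ge0// -expRD ler_expR.
  have -> : - x ^+ 2 / (s ^+ 2 *+ 2) = - u * x ^+ 2 - u * x ^+ 2.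
    by rewrite /u; field; rewrite s0.
  have -> : - x ^+ 2 / (s' ^+ 2 *+ 2) = - u * x ^+ 2.
    by rewrite /u /s' exprMn sqr_sqrtr//; field; rewrite s0.
  have : u * r <= u * x ^+ 2 by rewrite ler_pM2l// ltW.
  lra.
have mtail (r : R) : measurable [set x : R | r < x ^+ 2].
  have := @measurable_funX _ R R setT id 2 (@measurable_id _ _ _)
    measurableT `]r, +oo[%classic (measurable_itv _).
  by rewrite setTI; congr (measurable _); apply/seteqP; split=> x /=;
    rewrite in_itv/= andbT.
have tail_le r : (P [set w | (r < Y w ^+ 2)%R] <= (C * expR (- u * r))%:E)%E.
  have -> : [set w | r < Y w ^+ 2] = Y @^-1` [set x | r < x ^+ 2] by [].
  rewrite lawY// /normal_prob.
  have K0 : 0 <= C * expR (- u * r) by rewrite mulr_ge0// expR_ge0.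
  have mpdf : measurable_fun setT
      (fun x => ((C * expR (- u * r)) * normal_pdf 0 s' x)%:E).
    apply/measurable_EFinP; apply: measurable_funM => //.
    exact: measurable_normal_pdf.
  apply: (@le_trans _ _ (\int[lebesgue_measure]_(x in [set x | (r < x ^+ 2)%R])
      ((C * expR (- u * r)) * normal_pdf 0 s' x)%:E)%E).
    apply: ge0_le_integral.
    - exact: mtail.
    - by move=> x _; rewrite lee_fin normal_pdf_ge0.
    - apply/measurable_funTS/measurable_EFinP; exact: measurable_normal_pdf.
    - exact: measurable_funTS.
    - by move=> x rx; rewrite lee_fin; exact: pdf_le.
  apply: (@le_trans _ _ (\int[lebesgue_measure]_x
      ((C * expR (- u * r)) * normal_pdf 0 s' x)%:E)%E).
    apply: ge0_subset_integral => //; first exact: mtail.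
    by move=> x _; rewrite lee_fin mulr_ge0// normal_pdf_ge0.
  under eq_integral do rewrite EFinM.
  rewrite ge0_integralZl_EFin//; first by rewrite integral_normal_pdf mule1.
    by move=> x _; rewrite lee_fin normal_pdf_ge0.
  apply/measurable_EFinP; exact: measurable_normal_pdf.
rewrite ge0_expectation_tail//; first last.
- by move=> w; exact: sqr_ge0.
- exact: measurable_funX.
have mexp : measurable_fun setT (fun r : R => (C * expR (- u * r))%:E).
  apply/measurable_EFinP; apply: measurable_funM => //.
  apply: (measurableT_comp (@measurable_expR R)); exact: measurable_funM.
apply: (@le_lt_trans _ _ (\int[lebesgue_measure]_(r in `[0%R, +oo[)
    (C * expR (- u * r))%:E)%E).
  apply: ge0_le_integral => //.
  - pose Y2 : {mfun Omega >-> R} := HB.pack (fun w => Y w ^+ 2)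
      (isMeasurableFun.Build _ _ _ _ _ (measurable_funX 2 mY)).
    rewrite (_ : (fun r : R => _) = ccdf (Y2 : {RV P >-> R})).
      by apply: measurable_funTS; exact: ccdf_measurable.
    apply/funext => r; congr (P _).
    by apply/seteqP; split=> w /=; rewrite in_itv/= andbT.
  - exact: measurable_funTS.
have -> : (\int[lebesgue_measure]_(r in `[0%R, +oo[) (C * expR (- u * r))%:E =
    \int[lebesgue_measure]_(r in `[0%R, +oo[)
      ((C / u)%:E * (exponential_pdf u r)%:E))%E.
  apply: eq_integral => r; rewrite inE/= in_itv/= andbT => r0.
  rewrite -EFinM exponential_pdfE//; congr EFin.
  by field; rewrite gt_eqF.
have mpdf : measurable_fun setT (fun r => (exponential_pdf u r)%:E).
  by apply/measurable_EFinP; exact: measurable_exponential_pdf.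
have pdf0 r : (0 <= (exponential_pdf u r)%:E)%E.
  by rewrite lee_fin exponential_pdf_ge0// ltW.
rewrite ge0_integralZl_EFin//; last 2 first.
- exact: measurable_funTS.
- by rewrite divr_ge0// ltW.
apply: lte_mul_pinfty => //; first by rewrite lee_fin divr_ge0// ltW.
apply: (@le_lt_trans _ _ (\int[lebesgue_measure]_r (exponential_pdf u r)%:E)%E).
  exact: ge0_subset_integral.
by rewrite integral_exponential_pdf// ltry.
Qed.

Lemma eseries_finite_support (R : realType) (f : nat -> \bar R) n :
  (forall i, (n <= i)%N -> f i = 0%E) ->
  (\sum_(i <oo) f i = \sum_(i < n) f i)%E.
Proof.
move=> f0; apply: lim_near_cst => //; exists n => // m /= nm.
rewrite -(big_mkord xpredT) (big_cat_nat (n := n))//= [X in (_ + X)%E]big_nat_cond.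
by rewrite [X in (_ + X)%E]big1 ?adde0// => i; rewrite andbT => /andP[/f0].
Qed.

Lemma eseries_geometric (R : realType) (a z : R) : 0 <= z < 1 ->
  (\sum_(i <oo) (a * z ^+ i)%:E = (a / (1 - z))%:E)%E.
Proof.
move=> /andP[z0 z1]; have z1' : `|z| < 1 by rewrite ger0_norm.
transitivity (limn (EFin \o series (geometric a z))).
  by apply/congr_lim/funext => n /=; rewrite /series/= sumEFin.
rewrite EFin_lim; last exact: is_cvg_geometric_series.
by congr EFin; apply: cvg_lim => //; exact: cvg_geometric_series.
Qed.

(** Z is the sum over j of the indicators of {j < Z}, and a series of nonnegative functions is
    integrated term by term. *)
Lemma nat_expectation_tail d (Omega : measurableType d) (R : realType)
    (P : probability Omega R) (Z : Omega -> nat) : measurable_fun setT Z ->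
  ('E_P[fun w => ((Z w)%:R)%R] = \sum_(j <oo) P [set w | (j < Z w)%N])%E.
Proof.
move=> mZ.
have mj j : measurable [set w | (j < Z w)%N].
  by have := mZ measurableT [set k | (j < k)%N] I; rewrite setTI.
have iE j : (P [set w | (j < Z w)%N] =
    \int[P]_w (\1_[set w | (j < Z w)%N] w)%:E)%E.
  by rewrite integral_indic// setIT.
under eq_eseriesr do rewrite iE.
rewrite unlock -integral_nneseries//.
- apply: eq_integral => w _; rewrite (eseries_finite_support (n := Z w)).
    under eq_bigr => i _ do rewrite indicE mem_set//=.
    by rewrite sumEFin sumr_const card_ord.
  by move=> i iZ; rewrite indicE memNset//= ltnNge iZ.
- by move=> j; apply/measurable_EFinP; exact: measurable_indic.
Qed.

Section ge0_expectation.
Context d (Omega : measurableType d) (R : realType) (P : probability Omega R).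
Local Open Scope ereal_scope.

Lemma ge0_expectation_le (f g : Omega -> R) :
  measurable_fun setT f -> measurable_fun setT g ->
  (forall w, (0 <= f w)%R) -> (forall w, (f w <= g w)%R) -> 'E_P[f] <= 'E_P[g].
Proof.
move=> mf mg f0 fg; rewrite unlock; apply: ge0_le_integral => //.
- by move=> w _; rewrite lee_fin.
- exact/measurable_EFinP.
- exact/measurable_EFinP.
- by move=> w _; rewrite lee_fin.
Qed.

Lemma ge0_expectationD (f g : Omega -> R) :
  measurable_fun setT f -> measurable_fun setT g ->
  (forall w, (0 <= f w)%R) -> (forall w, (0 <= g w)%R) ->
  'E_P[fun w => (f w + g w)%R] = 'E_P[f] + 'E_P[g].
Proof.
move=> mf mg f0 g0; rewrite unlock -ge0_integralD//.
- by move=> w _; rewrite lee_fin.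
- exact/measurable_EFinP.
- by move=> w _; rewrite lee_fin.
- exact/measurable_EFinP.
Qed.

Lemma ge0_expectationZl (k : R) (f : Omega -> R) : (0 <= k)%R ->
  measurable_fun setT f -> (forall w, (0 <= f w)%R) ->
  'E_P[fun w => (k * f w)%R] = k%:E * 'E_P[f].
Proof.
move=> k0 mf f0; rewrite unlock -ge0_integralZl_EFin//.
- by move=> w _; rewrite lee_fin.
- exact/measurable_EFinP.
Qed.

Lemma ge0_expectation_sum_lty (I : Type) (s : seq I) (F : I -> Omega -> R) :
  (forall i, measurable_fun setT (F i)) -> (forall i w, (0 <= F i w)%R) ->
  (forall i, 'E_P[F i] < +oo) ->
  'E_P[fun w => (\sum_(i <- s) F i w)%R] < +oo.
Proof.
move=> mF F0 Foo; elim: s => [|i s IHs].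
  under [X in 'E_P[X]]eq_fun do rewrite big_nil.
  by rewrite expectation_cst ltry.
under [X in 'E_P[X]]eq_fun do rewrite big_cons.
rewrite ge0_expectationD//; first exact: lte_add_pinfty.
  by apply: measurable_sum.
by move=> w; exact: sumr_ge0.
Qed.

End ge0_expectation.

(** * Moments of the slot numbers and of the rate *)

Section observation_expectations.
Context (R : realType) (K L : nat) (sf2 sg2 p0 : R).
Context d (Omega : measurableType d) (P : probability Omega R).
Context (X : observations R K L Omega).
Hypothesis hX : channel_model sf2 sg2 p0 P X.
Hypotheses (hK : (1 <= K)%N) (hsg2 : 0 < sg2) (hp0 : 0 < p0 < 1).
Context (Ps Pr : R).
Hypotheses (hPs : 0 < Ps) (hPr : 0 < Pr).

Local Notation p := (success_prob K p0).

Lemma success_prob_gt0 : 0 < p.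
Proof.
case/andP: hp0 => p0_gt0 p0_lt1.
by rewrite /success_prob !mulr_gt0 ?ltr0n ?exprn_gt0// subr_gt0.
Qed.

(** In the model p is itself a probability, that of the event K_1 = 1. *)
Lemma success_prob_le1 : p <= 1.
Proof.
have := slots_geometric hX (ltn0Sn 0) (ltn0Sn 0); rewrite /= expr0 mulr1 => p1.
rewrite -lee_fin -p1; apply: probability_le1.
have := slots_measurable hX (ltn0Sn 0) measurableT (Y := [set 1%N]) I.
by rewrite setTI.
Qed.

(** The event splits over the values j + k + 1, all positive and hence of prescribed probability;
    what remains is a geometric series of ratio 1 - p. *)
Lemma slots_tail n j : (0 < n)%N ->
  P [set w | (j < slots X n w)%N] = ((1 - p) ^+ j)%:E.
Proof.
move=> n0.
rewrite (_ : mkset _ = \bigcup_k [set w | slots X n w = (j + k).+1]); last first.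
  apply/seteqP; split=> [w /= jw|w [k _ /= ->]]; last by rewrite ltnS leq_addr.
  by exists (slots X n w - j.+1)%N => //=; rewrite -addSn subnKC.
rewrite measure_bigcup//; last 2 first.
- move=> k _; have := slots_measurable hX n0 measurableT (Y := [set (j + k).+1]) I.
  by rewrite setTI.
- by move=> k l _ _ [w [/= -> [/addnI]]].
under eq_eseriesl do rewrite in_setT.
transitivity (\sum_(k <oo) (p * (1 - p) ^+ j * (1 - p) ^+ k)%:E)%E.
  apply: eq_eseriesr => k _; rewrite -mulrA -exprD.
  exact: (slots_geometric hX n0 (ltn0Sn (j + k))).
rewrite eseries_geometric; last first.
  by rewrite subr_ge0 success_prob_le1 gtrBl success_prob_gt0.
congr EFin; rewrite subKr mulrC mulKf//.
by rewrite gt_eqF// success_prob_gt0.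
Qed.

Lemma measurable_slots n : (0 < n)%N ->
  measurable_fun setT (fun w => (slots X n w)%:R : R).
Proof.
move=> n0; apply: (measurableT_comp (f := fun k : nat => k%:R : R)) => //.
exact: slots_measurable hX _ n0.
Qed.

Lemma expectation_slots n : (0 < n)%N ->
  ('E_P[fun w => ((slots X n w)%:R)%R] = (p^-1)%:E)%E.
Proof.
move=> n0; rewrite nat_expectation_tail; last exact: slots_measurable hX _ n0.
under eq_eseriesr do rewrite slots_tail// -[(1 - p) ^+ _]mul1r.
rewrite eseries_geometric; first by rewrite subKr mul1r.
by rewrite subr_ge0 success_prob_le1 gtrBl success_prob_gt0.
Qed.

(** Evaluating the product law on strips shows that the real and the imaginary part are each
    centered normal. *)
Lemma gainG_second_moment_lty n j i : (0 < n)%N ->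
  ('E_P[fun w => sqnorm (reim (gainG X n j i w))] < +oo)%E.
Proof.
move=> n0; have [mG lG] := gainG_gaussian hX j i n0.
set s := Num.sqrt (sg2 / 2) in lG.
have s0 : s != 0 by rewrite sqrtr_eq0 -ltNge divr_gt0.
have m1 : measurable_fun setT (fun w => (reim (gainG X n j i w)).1).
  exact: (measurableT_comp measurable_fst).
have m2 : measurable_fun setT (fun w => (reim (gainG X n j i w)).2).
  exact: (measurableT_comp measurable_snd).
rewrite ge0_expectationD//; try by move=> w; exact: sqr_ge0.
- apply: lte_add_pinfty.
  + apply: (normal_second_moment_lty s0 m1) => A mA.
    have := lG (A `*` setT) (measurableX mA measurableT).
    rewrite product_measure1E// [X in (_ * X)%E]probability_setT mule1 => <-.
    by congr (P _); apply/seteqP; split=> w // -[].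
  + apply: (normal_second_moment_lty s0 m2) => A mA.
    have := lG (setT `*` A) (measurableX measurableT mA).
    rewrite product_measure1E// [X in (X * _)%E]probability_setT mul1e => <-.
    by congr (P _); apply/seteqP; split=> w // -[].
- exact: measurable_funX.
- exact: measurable_funX.
Qed.

Lemma expectation_rate_lty n : (0 < n)%N -> ('E_P[rate Ps Pr X n] < +oo)%E.
Proof.
move=> n0.
(* Summing over all pairs and relays dominates at once the maximum over the relays and the random
   choice of the winner. *)
pose F (ij : 'I_K * 'I_L) w := Pr / ln 2 * sqnorm (reim (gainG X n ij.2 ij.1 w)).
have c0 : 0 <= Pr / ln 2 by rewrite divr_ge0 ?(ltW hPr)// ln_ge0// ler1n.
have F0 ij w : 0 <= F ij w by rewrite mulr_ge0// sqnorm_ge0.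
have mS ij : measurable_fun setT (fun w => sqnorm (reim (gainG X n ij.2 ij.1 w))).
  apply: (measurableT_comp (@measurable_sqnorm R)).
  exact: (gainG_gaussian hX _ _ n0).1.
have mF ij : measurable_fun setT (F ij) by apply: measurable_funM.
apply: (@le_lt_trans _ _ ('E_P[fun w => (\sum_(ij : 'I_K * 'I_L) F ij w)%R])%E).
  apply: ge0_expectation_le.
  - exact: (measurable_rate hX hPs hPr n0).
  - by apply: measurable_sum => ij; exact: mF.
  - by move=> w; exact: rate_ge0.
  move=> w; rewrite rateE; apply/bigmax_leP; split=> [|j _]; first exact: sumr_ge0.
  apply: (le_trans (pair_rate_le hPs hPr _)).
  rewrite (bigD1 (winner X n w, j))//= /F/= mulrAC lerDl.
  by apply: sumr_ge0 => ij _; exact: F0.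
apply: ge0_expectation_sum_lty => // ij.
rewrite ge0_expectationZl//; last by move=> w; exact: sqnorm_ge0.
by rewrite lte_mul_pinfty// gainG_second_moment_lty.
Qed.

End observation_expectations.

(** * The threshold equation *)

Section excess_reward.
Context (R : realType) (K L : nat) (sf2 sg2 p0 : R).
Context d (Omega : measurableType d) (P : probability Omega R).
Context (X : observations R K L Omega).
Hypothesis hX : channel_model sf2 sg2 p0 P X.
Hypotheses (hK : (1 <= K)%N) (hsg2 : 0 < sg2) (hp0 : 0 < p0 < 1).
Context (T tau Ps Pr : R).
Hypotheses (hT : 0 < T) (htau : 0 < tau) (hPs : 0 < Ps) (hPr : 0 < Pr).

Local Notation p := (success_prob K p0).

Definition excess (lam : R) (n : nat) (w : Omega) : R :=
  Num.max (T / 2 * rate Ps Pr X n w - lam * T) 0.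

Lemma excess_ge0 lam n w : 0 <= excess lam n w.
Proof. by rewrite le_max lexx orbT. Qed.

Lemma measurable_excess_gen lam n : measurable_fun setT (excess lam n :
  g_sigma_algebraType (\bigcup_(k in [set k | obs_of k = n]) rv_sigma X k) -> R).
Proof.
apply: measurable_maxr => //; apply: measurable_funB => //.
by apply: measurable_funM => //; exact: measurable_rate_gen.
Qed.

Lemma measurable_excess lam n : (0 < n)%N -> measurable_fun setT (excess lam n).
Proof.
move=> n0; apply: measurable_fun_g_sigma (@measurable_excess_gen lam n).
by apply: (rv_gen_measurable hX) => k /= ->.
Qed.

Lemma lt_excess (lam r : R) n w : 0 <= r ->
  (r < excess lam n w) = ((r + lam * T) / (T / 2) < rate Ps Pr X n w).
Proof.
move=> r0; rewrite lt_max [r < 0]ltNge r0 orbF ltrBrDr ltr_pdivrMr ?divr_gt0//.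
by rewrite [rate _ _ _ _ _ * _]mulrC.
Qed.

Lemma expectation_excess_law lam n : (0 < n)%N ->
  ('E_P[excess lam n] = 'E_P[excess lam 1])%E.
Proof.
move=> n0; rewrite !ge0_expectation_tail//; try exact: excess_ge0.
- apply: eq_integral => r; rewrite inE/= in_itv/= andbT => r0.
  under eq_set do rewrite lt_excess//.
  rewrite (rate_tail_law hX hPs hPr _ n0).
  by congr (P _); apply/seteqP; split=> w /=; rewrite lt_excess.
- exact: measurable_excess.
- exact: measurable_excess.
Qed.

(** Changing [lam] by delta moves T/2 R - lam T by T |delta|, and the positive part is 1-Lipschitz.
    The additive form makes sense before finiteness is known, and finiteness is deduced from it by
    taking y = 0. *)
Lemma expectation_excess_lipschitz (x y : R) :
  ('E_P[excess x 1] <= 'E_P[excess y 1] + (T * `|x - y|)%:E)%E.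
Proof.
have c0 : 0 <= T * `|x - y| by rewrite mulr_ge0// ltW.
rewrite -(expectation_cst P (T * `|x - y|)) -ge0_expectationD//.
- apply: ge0_expectation_le.
  + exact: measurable_excess.
  + by apply: measurable_funD => //; exact: measurable_excess.
  + exact: excess_ge0.
  move=> w; rewrite ge_max /cst; apply/andP; split; last first.
    by rewrite addr_ge0// excess_ge0.
  apply: (@le_trans _ _ (T / 2 * rate Ps Pr X 1 w - y * T + T * `|x - y|)).
    have := ler_norm (y - x); rewrite distrC => /(ler_wpM2l (ltW hT)).
    rewrite mulrBr; lra.
  by rewrite lerD2r le_max lexx.
- exact: measurable_excess.
- exact: excess_ge0.
Qed.

Lemma expectation_excess_nonincreasing (x y : R) : x <= y ->
  ('E_P[excess y 1] <= 'E_P[excess x 1])%E.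
Proof.
move=> xy; apply: ge0_expectation_le.
- exact: measurable_excess.
- exact: measurable_excess.
- exact: excess_ge0.
move=> w; rewrite ge_max !le_max lexx orbT andbT; apply/orP; left.
by rewrite lerD2l lerN2 ler_pM2r.
Qed.

Lemma expectation_excess_fin_num x : ('E_P[excess x 1] \is a fin_num)%E.
Proof.
have ex0 y : (0 <= 'E_P[excess y 1])%E by apply: expectation_ge0 => w; exact: excess_ge0.
rewrite ge0_fin_numE//; apply: (le_lt_trans (expectation_excess_lipschitz x 0)).
rewrite lte_add_pinfty ?ltry//.
have -> : excess 0 1 = fun w => T / 2 * rate Ps Pr X 1 w.
  apply/funext => w; rewrite /excess mul0r subr0; apply/max_idPl.
  by rewrite mulr_ge0 ?rate_ge0// divr_ge0// ltW.
have T2 : 0 <= T / 2 by rewrite divr_ge0// ltW.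
rewrite ge0_expectationZl//.
- by rewrite lte_mul_pinfty// (expectation_rate_lty hX hsg2 hPs hPr).
- exact: (measurable_rate hX).
- by move=> w; exact: rate_ge0.
Qed.

Lemma threshold_equationE lam : threshold_equation T tau Ps Pr p0 P X lam <->
  ('E_P[excess lam 1] = (lam * tau / p)%:E)%E.
Proof.
split=> [eq_lam|eq_lam n n0]; first exact: eq_lam.
by rewrite -eq_lam; exact: expectation_excess_law.
Qed.

Lemma threshold_exists :
  exists lam, 0 <= lam /\ threshold_equation T tau Ps Pr p0 P X lam.
Proof.
pose e x := fine ('E_P[excess x 1])%E.
have eE x : ('E_P[excess x 1] = (e x)%:E)%E.
  by rewrite /e fineK// expectation_excess_fin_num.
have e_ge0 x : 0 <= e x.
  by rewrite -lee_fin -eE; apply: expectation_ge0 => w; exact: excess_ge0.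
have p_gt0 := success_prob_gt0 hK hp0.
have e_lip x y : `|e x - e y| <= T * `|x - y|.
  have lip u v : e u - e v <= T * `|u - v|.
    by rewrite lerBlDl -lee_fin EFinD -!eE; exact: expectation_excess_lipschitz.
  by rewrite ler_norml lip lerNl opprB distrC lip.
have e_cont : continuous e.
  move=> x; apply/cvgrPdist_le => /= eps eps0.
  have eT : 0 < eps / T by rewrite divr_gt0.
  near=> y; apply: (le_trans (e_lip x y)).
  rewrite mulrC -ler_pdivlMr//; near: y.
pose f x := e x - x * (tau / p).
have f_cont : continuous f.
  move=> x; apply: (@cvgB _ R^o); first exact: e_cont.
  by apply: (@cvgM R R^o); [exact: cvg_id|exact: cvg_cst].
have tp : 0 < tau / p by rewrite divr_gt0.
(* At this point the linear side M tau / p equals e 0, which is at least e M by monotonicity; hence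
   f changes sign on [0, M]. *)
pose M := e 0 / (tau / p).
have M0 : 0 <= M by rewrite divr_ge0// ltW.
have f0 : 0 <= f 0 by rewrite /f mul0r subr0.
have fM : f M <= 0.
  rewrite /f /M divfK ?gt_eqF// subr_le0 -lee_fin -!eE.
  exact: expectation_excess_nonincreasing.
have [lam] : exists2 c, c \in `[0, M] & f c = 0.
  apply: IVT => //; first exact: continuous_subspaceT.
  by rewrite ge_min fM orbT le_max f0.
rewrite in_itv/= => /andP[lam0 _] flam; exists lam; split=> //.
apply/threshold_equationE; rewrite eE; congr EFin.
by apply/eqP; rewrite -subr_eq0 -mulrA; apply/eqP.
Unshelve. all: by end_near. Qed.

Lemma threshold_unique x y : threshold_equation T tau Ps Pr p0 P X x ->
  threshold_equation T tau Ps Pr p0 P X y -> x = y.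
Proof.
have p_gt0 := success_prob_gt0 hK hp0.
wlog xy : x y / x < y => [W hx hy|].
  by have [/W->|/W->|->] := ltgtP x y.
move=> /threshold_equationE ex /threshold_equationE ey.
have := expectation_excess_nonincreasing (ltW xy).
by rewrite ex ey lee_fin -!mulrA ler_pM2r ?divr_gt0// leNgt xy.
Qed.

End excess_reward.

(** * Wald's identity and optimality *)

Section wald.
Context (R : realType) (K L : nat) (sf2 sg2 p0 : R).
Context d (Omega : measurableType d) (P : probability Omega R).
Context (X : observations R K L Omega).
Hypothesis hX : channel_model sf2 sg2 p0 P X.
Context (N : Omega -> option nat).
Hypotheses (N_pos : forall w, N w <> Some 0%N)
  (N_adapted : forall n, (0 < n)%N -> filtration X n [set w | N w = Some n]).

Local Notation rv_gen A := (\bigcup_(k in A) rv_sigma X k).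

(* The event N >= n, never stopping included. *)
Definition not_before (n : nat) : set Omega :=
  [set w | forall m, (m < n)%N -> N w <> Some m].

Lemma measurable_stop n : measurable [set w | N w = Some n].
Proof.
(* Adaptedness is assumed for positive times only; at time 0 the event is empty by [N_pos]. *)
case: n => [|n]; last exact: (filtration_measurable hX (N_adapted (ltn0Sn n))).
have -> : [set w | N w = Some 0%N] = set0; last exact: measurable0.
by apply/seteqP; split=> // w /= /N_pos.
Qed.

Lemma measurable_never : measurable [set w | N w = None].
Proof.
rewrite (_ : mkset _ = ~` \bigcup_n [set w | N w = Some n]).
  by apply: measurableC; apply: bigcup_measurable => n _; exact: measurable_stop.
apply/seteqP; split=> [w /= Nw [n _ /=]|w /= Nw]; first by rewrite Nw.
by case Nwn : (N w) => [n|//]; exfalso; apply: Nw; exists n.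
Qed.

Lemma not_before_gen n :
  <<s rv_gen [set k | (0 < obs_of k < n)%N] >> (not_before n).
Proof.
pose S := g_sigma_algebraType (rv_gen [set k | (0 < obs_of k < n)%N]).
have mS m : (m < n)%N -> @measurable _ S [set w | N w = Some m].
  case: m => [|m] mn.
    have -> : [set w | N w = Some 0%N] = set0; last exact: measurable0.
    by apply/seteqP; split=> // w /= /N_pos.
  have := filtration_sub (N_adapted (ltn0Sn m)).
  apply: sub_sigma_algebra2 => A [k /= /andP[k0 km]]; exists k => //=.
  by rewrite k0 (leq_ltn_trans km).
rewrite (_ : not_before n = ~` \bigcup_(m in [set m | (m < n)%N]) [set w | N w = Some m]).
  apply: (@measurableC _ S); apply: (@bigcup_measurable _ S) => m /= mn.
  exact: mS.
apply/seteqP; split=> [w Nw [m mn]|w Nw m mn Nwm]; first exact: Nw.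
by apply: Nw; exists m.
Qed.

Lemma measurable_not_before n : measurable (not_before n).
Proof.
apply: (g_sigma_sub_measurable _ (not_before_gen (n := n))).
by apply: (rv_gen_measurable hX) => k /= /andP[].
Qed.

Lemma indep_not_before n S : (0 < n)%N ->
  <<s rv_gen [set k | obs_of k = n] >> S ->
  P (S `&` not_before n) = (P S * P (not_before n))%E.
Proof.
move=> n0 nS; apply: (rv_gen_indep hX _ _ _ nS (not_before_gen (n := n))).
- by move=> k /= ->.
- by move=> k /= /andP[].
- by apply/seteqP; split=> // k [/= ->]; rewrite ltnn andbF.
Qed.

Lemma measurable_stopped (Z : nat -> Omega -> R) :
  (forall n, (0 < n)%N -> measurable_fun setT (Z n)) ->
  measurable_fun setT (stopped Z N).
Proof.
move=> mZ _ B mB; rewrite setTI.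
rewrite (_ : _ @^-1` B = ([set w | N w = None] `&` (fun=> 0) @^-1` B) `|`
    \bigcup_(n in [set n | (0 < n)%N]) ([set w | N w = Some n] `&` Z n @^-1` B)).
  apply: measurableU.
    apply: measurableI; first exact: measurable_never.
    by rewrite preimage_cst; case: ifP.
  apply: bigcup_measurable => n n0; apply: measurableI; first exact: measurable_stop.
  by have := mZ n n0 measurableT B mB; rewrite setTI.
apply/seteqP; split=> w; rewrite /stopped /=.
  case Nw : (N w) => [[|n]|] ZB; [by case: (N_pos Nw)|right|by left].
  by exists n.+1.
by move=> [[/= Nw]|[n _ [/= Nw]]]; rewrite Nw.
Qed.

Hypothesis N_finite : P [set w | N w = None] = 0%E.

(** The comparison is required only where the rule stops, since the complement is a null set; this
    neutralizes the default value of [stopped]. *)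
Lemma stopped_expectation_le (f g : Omega -> R) :
  measurable_fun setT f -> measurable_fun setT g ->
  (forall w, 0 <= f w) -> (forall w, 0 <= g w) ->
  (forall w n, (0 < n)%N -> N w = Some n -> f w <= g w) ->
  ('E_P[f] <= 'E_P[g])%E.
Proof.
move=> mf mg f0 g0 fg; apply: expectation_le => //.
exists [set w | N w = None]; split=> //; first exact: measurable_never.
move=> w /= fgw; case Nw : (N w) => [[|n]|//]; first by case: (N_pos Nw).
by exfalso; apply: fgw; exact: fg Nw.
Qed.

Lemma stopped_expectation_eq (f g : Omega -> R) :
  measurable_fun setT f -> measurable_fun setT g ->
  (forall w, 0 <= f w) -> (forall w, 0 <= g w) ->
  (forall w n, (0 < n)%N -> N w = Some n -> f w = g w) ->
  ('E_P[f] = 'E_P[g])%E.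
Proof.
move=> mf mg f0 g0 fg; apply/eqP; rewrite eq_le; apply/andP.
by split; apply: stopped_expectation_le => // w n n0 /(fg _ _ n0) ->.
Qed.

Lemma stopped_ge0 (Z : nat -> Omega -> R) : (forall n w, 0 <= Z n w) ->
  forall w, 0 <= stopped Z N w.
Proof. by move=> Z0 w; rewrite /stopped; case: (N w). Qed.

(** This is E N, written as the sum of P(N >= i) over i >= 1; it may be infinite. *)
Definition mean_stop : \bar R := (\sum_(i <oo) P (not_before i.+1))%E.

Lemma mean_stop_ge0 : (0 <= mean_stop)%E.
Proof. exact: nneseries_ge0. Qed.

Lemma wald_identity (Z : nat -> Omega -> R) (c : R) :
  (forall n w, 0 <= Z n w) ->
  (forall n, measurable_fun setT
    (Z n : g_sigma_algebraType (rv_gen [set k | obs_of k = n]) -> R)) ->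
  (forall n, (0 < n)%N -> ('E_P[Z n] = c%:E)%E) ->
  ('E_P[stopped (fun n w => \sum_(1 <= i < n.+1) Z i w)%R N] =
   c%:E * mean_stop)%E.
Proof.
move=> Z0 mZ EZ.
have gen_m n : (0 < n)%N -> rv_gen [set k | obs_of k = n] `<=` measurable.
  by move=> n0; apply: (rv_gen_measurable hX) => k /= ->.
have mZn n : (0 < n)%N -> measurable_fun setT (Z n).
  by move=> n0; exact: measurable_fun_g_sigma (gen_m n n0) (mZ n).
(* The stopped sum is the full series of Z_i on {N >= i}, whose terms have factoring expectations.
   The shift by one reconciles series indexed from 0 with observations numbered from 1. *)
pose term i w := (Z i.+1 w * \1_(not_before i.+1) w)%R.
have term0 i w : 0 <= term i w by rewrite mulr_ge0// indicE.
have mterm i : measurable_fun setT (term i).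
  apply: measurable_funM; first exact: mZn.
  exact/measurable_indic/measurable_not_before.
rewrite /mean_stop -nneseriesZl//.
transitivity (\sum_(i <oo) 'E_P[term i])%E; last first.
  apply: eq_eseriesr => i _; rewrite -(EZ i.+1)//.
  apply: (indep_expectation (gen_m i.+1 _)) => //.
    exact: measurable_not_before.
  by move=> S; exact: indep_not_before.
rewrite unlock -integral_nneseries//; last 2 first.
- by move=> i; apply/measurable_EFinP; exact: mterm.
- by move=> i w _; rewrite lee_fin term0.
apply: ge0_ae_eq_integral => //.
- apply/measurable_EFinP/measurable_stopped => n n0.
  under eq_fun do rewrite big_add1.
  by apply: measurable_sum => i; exact: mZn.
- apply: ge0_emeasurable_sum => [i w _ _|i _]; first by rewrite lee_fin.
  by apply/measurable_EFinP; exact: mterm.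
- by move=> w _; rewrite lee_fin; apply: stopped_ge0 => n {}w; exact: sumr_ge0.
- by move=> w _; apply: nneseries_ge0 => i _ _; rewrite lee_fin.
(* Without stopping, the left side is the default 0 while the series runs over all observations, so
   the two agree only almost surely. *)
exists [set w | N w = None]; split=> //; first exact: measurable_never.
move=> w /= h; case Nw : (N w) => [n|//]; exfalso; apply: h => _.
rewrite /stopped Nw (eseries_finite_support (n := n)) => [|i ni]; last first.
  rewrite /term indicE memNset ?mulr0//= => /(_ n); rewrite ltnS ni => /(_ isT).
  by rewrite Nw.
rewrite sumEFin big_add1/= big_mkord; congr EFin; apply: eq_bigr => i _.
rewrite /term indicE mem_set ?mulr1//= => m; rewrite ltnS => mi.
by rewrite Nw => -[nm]; move: mi; rewrite -nm leqNgt ltn_ord.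
Qed.

End wald.

Section first_time.
Variable q : pred nat.

Lemma first_timeP n : first_time q = Some n <->
  [/\ (0 < n)%N, q n & forall m, (0 < m < n)%N -> ~~ q m].
Proof.
rewrite /first_time; case: pselect => [ex|nex]; last first.
  by split=> // -[n0 qn _]; exfalso; apply: nex; exists n; rewrite n0.
case: ex_minnP => k /andP[k0 qk] kmin; split=> [[<-]|[n0 qn nmin]].
  split=> // m /andP[m0 mk]; apply/negP => qm.
  by have := kmin m; rewrite m0 qm leqNgt mk => /(_ isT).
congr Some; apply/eqP; rewrite eqn_leq kmin ?n0//= leqNgt; apply/negP => kn.
by have := nmin k; rewrite k0 kn qk => /(_ isT).
Qed.

(** By strong induction: a success at m with none before it would make m the first time. The
    hypothesis excludes early stopping rather than fixing a value, so it also covers never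
    stopping. *)
Lemma first_time_not_before n m :
  (forall l, (l < n)%N -> first_time q <> Some l) -> (0 < m < n)%N -> ~~ q m.
Proof.
move=> none; elim/ltn_ind: m => m IHm /andP[m0 mn]; apply/negP => qm.
apply: (none m mn); apply/first_timeP; split=> // l /andP[l0 lm].
by apply: IHm => //; rewrite l0 (ltn_trans lm).
Qed.

End first_time.

Section optimal_stopping.
Context (R : realType) (K L : nat) (sf2 sg2 p0 : R).
Context d (Omega : measurableType d) (P : probability Omega R).
Context (X : observations R K L Omega).
Hypothesis hX : channel_model sf2 sg2 p0 P X.
Hypotheses (hK : (1 <= K)%N) (hp0 : 0 < p0 < 1).
Context (T tau Ps Pr : R).
Hypotheses (hT : 0 < T) (htau : 0 < tau) (hPs : 0 < Ps) (hPr : 0 < Pr).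

Local Notation p := (success_prob K p0).
Local Notation exc := (excess X T Ps Pr).
Local Notation rv_gen A := (\bigcup_(k in A) rv_sigma X k).

Lemma measurable_time_cost n : measurable_fun setT (time_cost T tau X n).
Proof.
apply: measurable_funD => //; apply: measurable_funM => //.
under eq_fun do rewrite big_add1.
by apply: measurable_sum => i; exact: (measurable_slots hX).
Qed.

Lemma time_cost_ge0 n w : 0 <= time_cost T tau X n w.
Proof. by rewrite addr_ge0 ?(ltW hT)// mulr_ge0 ?(ltW htau)// sumr_ge0. Qed.

Lemma measurable_reward n : (0 < n)%N -> measurable_fun setT (reward T Ps Pr X n).
Proof.
move=> n0; apply: measurable_funM => //; exact: (measurable_rate hX hPs hPr n0).
Qed.

Lemma reward_ge0 n w : 0 <= reward T Ps Pr X n w.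
Proof. by rewrite mulr_ge0 ?rate_ge0// divr_ge0// ltW. Qed.

Section stopping_time.
Context (N : Omega -> option nat).
Hypotheses (N_pos : forall w, N w <> Some 0%N)
  (N_adapted : forall n, (0 < n)%N -> filtration X n [set w | N w = Some n])
  (N_finite : P [set w | N w = None] = 0%E).

Let measurable_stopped_sum (Z : nat -> Omega -> R) :
  (forall n, (0 < n)%N -> measurable_fun setT (Z n)) ->
  measurable_fun setT (stopped (fun n w => \sum_(1 <= i < n.+1) Z i w) N).
Proof.
move=> mZ; apply: (measurable_stopped hX N_pos N_adapted) => n n0.
under eq_fun do rewrite big_add1.
by apply: measurable_sum => i; exact: mZ.
Qed.

(** Holds even if both sides are infinite; hence it also serves to establish that the threshold rule
    has finite expected time. *)
Lemma expectation_stopped_time_cost :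
  ('E_P[stopped (time_cost T tau X) N] =
   T%:E + (tau / p)%:E * mean_stop P N)%E.
Proof.
pose S := stopped (fun n w => \sum_(1 <= i < n.+1) ((slots X i w)%:R : R)) N.
have mS : measurable_fun setT S.
  by apply: measurable_stopped_sum => n; exact: (measurable_slots hX).
have S0 w : 0 <= S w by apply: stopped_ge0 => n {}w; exact: sumr_ge0.
have T0 := ltW hT; have tau0 := ltW htau.
transitivity ('E_P[fun w => (cst T w + tau * S w)%R])%E.
  apply: (stopped_expectation_eq hX N_pos N_adapted N_finite).
  - apply: (measurable_stopped hX N_pos N_adapted) => n _.
    exact: measurable_time_cost.
  - by apply: measurable_funD => //; exact: measurable_funM.
  - by apply: stopped_ge0 => n w; exact: time_cost_ge0.
  - by move=> w; rewrite addr_ge0// mulr_ge0.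
  - by move=> w n _ Nw; rewrite /S /stopped Nw.
rewrite ge0_expectationD//; first last.
- by move=> w; rewrite mulr_ge0.
- exact: measurable_funM.
rewrite expectation_cst ge0_expectationZl// EFinM -muleA; congr (_ + _ * _)%E.
apply: (wald_identity hX N_pos N_adapted N_finite
  (Z := fun n w => (slots X n w)%:R)) => //.
- move=> n; apply: (measurableT_comp (f := fun k : nat => k%:R : R)) => //.
  exact: (rv_gen_measurable_fun (k := Slots K L n)).
- by move=> n n0; exact: (expectation_slots hX).
Qed.

Context (lam : R).
Hypotheses (lam0 : 0 <= lam)
  (eq_lam : threshold_equation T tau Ps Pr p0 P X lam).

Let S := stopped (fun n w => \sum_(1 <= i < n.+1) exc lam i w) N.

Let mS : measurable_fun setT S.
Proof. by apply: measurable_stopped_sum => n; exact: (measurable_excess hX). Qed.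

Let S0 w : 0 <= S w.
Proof.
by apply: stopped_ge0 => n {}w; apply: sumr_ge0 => i _; exact: excess_ge0.
Qed.

Let lamT0 : 0 <= lam * T. Proof. by rewrite mulr_ge0// ltW. Qed.

(** The equation for [lam] enters here: with E U_1 = lam tau / p, Wald's identity gives lam T + (lam
    tau / p) E N, which is [lam] times the expected time. *)
Let expectation_bound : ('E_P[fun w => (cst (lam * T) w + S w)%R] =
  lam%:E * 'E_P[stopped (time_cost T tau X) N])%E.
Proof.
have p_gt0 := success_prob_gt0 hK hp0.
rewrite ge0_expectationD// expectation_cst.
rewrite (wald_identity hX N_pos N_adapted N_finite (c := lam * tau / p)).
- rewrite expectation_stopped_time_cost ge0_muleDr ?lee_fin ?(ltW hT)//; last first.
    by rewrite mule_ge0 ?mean_stop_ge0// lee_fin divr_ge0// ltW.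
  by rewrite muleA -!EFinM mulrA.
- by move=> n w; exact: excess_ge0.
- by move=> n; exact: measurable_excess_gen.
- exact: eq_lam.
Qed.

Lemma expectation_stopped_reward_le :
  ('E_P[stopped (reward T Ps Pr X) N] <=
   lam%:E * 'E_P[stopped (time_cost T tau X) N])%E.
Proof.
rewrite -expectation_bound.
apply: (stopped_expectation_le hX N_pos N_adapted N_finite).
- by apply: (measurable_stopped hX N_pos N_adapted); exact: measurable_reward.
- exact: measurable_funD.
- by apply: stopped_ge0 => n w; exact: reward_ge0.
- by move=> w; rewrite addr_ge0.
move=> w n n0 Nw; rewrite /S /stopped Nw -lerBlDl /cst.
rewrite big_nat_recr//= (le_trans (y := exc lam n w))//.
  by rewrite le_max lexx.
by rewrite lerDr; apply: sumr_ge0 => i _; exact: excess_ge0.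
Qed.

Lemma expectation_stopped_reward_eq :
  (forall w n, N w = Some n -> 2 * lam <= rate Ps Pr X n w) ->
  (forall w n m, N w = Some n -> (0 < m < n)%N -> rate Ps Pr X m w < 2 * lam) ->
  ('E_P[stopped (reward T Ps Pr X) N] =
   lam%:E * 'E_P[stopped (time_cost T tau X) N])%E.
Proof.
move=> rate_ge rate_lt; rewrite -expectation_bound.
apply: (stopped_expectation_eq hX N_pos N_adapted N_finite).
- by apply: (measurable_stopped hX N_pos N_adapted); exact: measurable_reward.
- exact: measurable_funD.
- by apply: stopped_ge0 => n w; exact: reward_ge0.
- by move=> w; rewrite addr_ge0.
move=> w n n0 Nw; rewrite /S /stopped Nw /cst big_nat_recr//=.
(* This factorization is the origin of the threshold 2 lam: the excess is positive exactly when the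
   rate is above it. *)
have excE x : T / 2 * x - lam * T = T / 2 * (x - 2 * lam) by field.
have T2 : 0 < T / 2 by rewrite divr_gt0.
rewrite big_nat big1 => [|m mn]; last first.
  apply/max_idPr; rewrite excE pmulr_rle0// subr_le0 ltW//.
  exact: rate_lt Nw mn.
rewrite add0r /excess (max_idPl _) ?subrKC// excE pmulr_rge0// subr_ge0.
exact: rate_ge Nw.
Qed.

End stopping_time.

End optimal_stopping.

(** * Admissibility and throughput of the threshold rule *)

Section threshold_rule.
Context (R : realType) (K L : nat) (sf2 sg2 p0 : R).
Context d (Omega : measurableType d) (P : probability Omega R).
Context (X : observations R K L Omega).
Hypothesis hX : channel_model sf2 sg2 p0 P X.
Hypotheses (hK : (1 <= K)%N) (hp0 : 0 < p0 < 1).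
Context (T tau Ps Pr : R).
Hypotheses (hT : 0 < T) (htau : 0 < tau) (hPs : 0 < Ps) (hPr : 0 < Pr).
Context (lam : R).
Hypotheses (lam0 : 0 <= lam)
  (eq_lam : threshold_equation T tau Ps Pr p0 P X lam).

Local Notation p := (success_prob K p0).
Local Notation N := (threshold_rule Ps Pr X lam).
Local Notation rv_gen A := (\bigcup_(k in A) rv_sigma X k).

Lemma threshold_rule_pos w : N w <> Some 0%N.
Proof. by move=> /first_timeP[]. Qed.

Lemma threshold_rule_ge w n : N w = Some n -> 2 * lam <= rate Ps Pr X n w.
Proof. by move=> /first_timeP[]. Qed.

Lemma threshold_rule_lt w n m : N w = Some n -> (0 < m < n)%N ->
  rate Ps Pr X m w < 2 * lam.
Proof. by move=> /first_timeP[_ _ +] mn => /(_ m mn); rewrite -ltNge. Qed.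

Lemma threshold_rule_adapted n : (0 < n)%N ->
  filtration X n [set w | N w = Some n].
Proof.
move=> n0.
pose S := g_sigma_algebraType
  (\bigcup_(m in [set m | (1 <= m <= n)%N]) observed X m).
rewrite (_ : mkset _ = (rate Ps Pr X n @^-1` `[2 * lam, +oo[) `&`
    \bigcap_(m in [set m | (0 < m < n)%N]) (rate Ps Pr X m @^-1` `]-oo, 2 * lam[)).
  apply: (@measurableI _ S).
    by apply: measurable_rate_filtration; rewrite ?n0/=.
  apply: (@bigcap_measurableType _ S) => m /= /andP[m0 mn].
  by apply: measurable_rate_filtration; rewrite // m0 ltnW.
apply/seteqP; split=> w /=.
  move=> Nw; rewrite in_itv/= andbT threshold_rule_ge//; split=> // m /= mn.
  by rewrite in_itv/=; exact: threshold_rule_lt Nw mn.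
rewrite in_itv/= andbT => -[ge_n lt_m]; apply/first_timeP; split=> // m mn.
by have := lt_m m mn; rewrite /= in_itv/= -ltNge.
Qed.

(** If R_1 > 2 lam had probability zero, the expected excess would vanish, against the equation when
    lam > 0. So q = P(R_1 > 2 lam) is positive and b = 1 - q works for all n, the law being common.
    For lam <= 0 the nonnegative rate is never below the threshold, and b = 0. *)
Lemma rate_below_threshold : exists b : R, 0 <= b < 1 /\
  forall n, (0 < n)%N -> (P [set w | (rate Ps Pr X n w < 2 * lam)%R] <= b%:E)%E.
Proof.
have [lam_gt0|lam_le0] := ltP 0 lam; last first.
  exists 0; split=> [|n _]; first by rewrite lexx ltr01.
  rewrite (_ : mkset _ = set0) ?measure0//; apply/seteqP; split=> // w /=.
  have := rate_ge0 Ps Pr X n w; lra.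
have m_gt n : (0 < n)%N -> measurable [set w | 2 * lam < rate Ps Pr X n w].
  move=> n0; have := measurable_rate hX hPs hPr n0 measurableT
    (measurable_itv `]2 * lam, +oo[).
  rewrite setTI; congr (measurable _).
  by apply/seteqP; split=> w /=; rewrite in_itv/= andbT.
pose q := fine (P [set w | 2 * lam < rate Ps Pr X 1 w]).
have qE : P [set w | 2 * lam < rate Ps Pr X 1 w] = q%:E.
  by rewrite /q fineK// fin_num_measure//; exact: m_gt.
have q_le1 : q <= 1 by rewrite -lee_fin -qE probability_le1//; exact: m_gt.
have q_gt0 : 0 < q.
  rewrite lt_neqAle -lee_fin -qE measure_ge0 andbT; apply/eqP => q0.
  have := eq_lam (ltn0Sn 0).
  rewrite -[X in ('E_P[X])%E]/(excess X T Ps Pr lam 1) ge0_expectation_tail.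
  - rewrite integral0_eq => [|r /=].
      move=> /esym/eqP; rewrite eqe gt_eqF//.
      by apply: divr_gt0; [exact: mulr_gt0|exact: success_prob_gt0].
    rewrite in_itv/= andbT => r0; apply/eqP; rewrite -measure_le0.
    apply: (@le_trans _ _ q%:E); last by rewrite -q0.
    rewrite -qE; apply: le_measure; rewrite ?inE.
    + have := measurable_excess hX T hPs hPr lam (ltn0Sn 0) measurableT
        (measurable_itv `]r, +oo[).
      rewrite setTI; congr (measurable _).
      by apply/seteqP; split=> w /=; rewrite in_itv/= andbT.
    + exact: m_gt.
    move=> w /=; rewrite lt_excess// => /(le_lt_trans _); apply.
    rewrite ler_pdivlMr ?divr_gt0//; move: r0; lra.
  - exact: (measurable_excess hX).
  - by move=> w; exact: excess_ge0.
exists (1 - q); split=> [|n n0]; first by rewrite subr_ge0 q_le1 gtrBl.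
have <- : P (~` [set w | 2 * lam < rate Ps Pr X n w]) = (1 - q)%:E.
  rewrite probability_setC; last exact: m_gt.
  by rewrite (rate_tail_law hX hPs hPr _ n0) qE.
apply: le_measure; rewrite ?inE.
- by have := measurable_rate hX hPs hPr n0 measurableT
    (measurable_itv `]-oo, 2 * lam[); rewrite setTI.
- by apply: measurableC; exact: m_gt.
by move=> w /= rw; apply/negP; rewrite -leNgt ltW.
Qed.

(** Going past observation i + 1 requires R_(i+1) < 2 lam, an event independent of having reached
    it; each observation thus costs a factor b. Almost sure stopping and a finite mean both
    follow. *)
Lemma threshold_rule_not_before : exists b : R, 0 <= b < 1 /\
  forall i, (P (not_before N i.+1) <= (b ^+ i)%:E)%E.
Proof.
have [b [/andP[b0 b1] rate_b]] := rate_below_threshold.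
exists b; split=> [|]; first by rewrite b0.
pose below n := [set w | rate Ps Pr X n w < 2 * lam].
have below_gen n : <<s rv_gen [set k | obs_of k = n] >> (below n).
  have mR : measurable_fun setT (rate Ps Pr X n :
    g_sigma_algebraType (rv_gen [set k | obs_of k = n]) -> R).
    exact: measurable_rate_gen.
  by have := mR measurableT _ (measurable_itv `]-oo, 2 * lam[); rewrite setTI.
have m_below n : (0 < n)%N -> measurable (below n).
  move=> n0; apply: (g_sigma_sub_measurable _ (below_gen n)).
  by apply: (rv_gen_measurable hX) => k /= ->.
have m_nb := measurable_not_before hX threshold_rule_pos threshold_rule_adapted.
elim=> [|i IHi]; first by rewrite expr0 probability_le1.
apply: (@le_trans _ _ (P (below i.+1 `&` not_before N i.+1))).
  apply: le_measure; rewrite ?inE//; first by apply: measurableI => //; exact: m_below.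
  move=> w nb; split.
    by have := first_time_not_before nb (m := i.+1) (ltnSn _); rewrite -ltNge.
  by move=> m mi; apply: nb; exact: ltnW.
rewrite (indep_not_before hX threshold_rule_pos threshold_rule_adapted)//.
by rewrite exprS EFinM lee_pmul// rate_b.
Qed.

Lemma threshold_rule_finite : P [set w | N w = None] = 0%E.
Proof.
have [b [/andP[b0 b1] nb_b]] := threshold_rule_not_before.
have mN := measurable_never hX threshold_rule_pos threshold_rule_adapted.
have [r rE] : exists r, P [set w | N w = None] = r%:E.
  by exists (fine (P [set w | N w = None])); rewrite fineK// fin_num_measure.
apply/eqP; rewrite eq_le measure_ge0 andbT rE lee_fin.
have cvg_b : (fun i => b ^+ i) @ \oo --> (0 : R).
  by apply: cvg_expr; rewrite ger0_norm.
rewrite -(cvg_lim (@Rhausdorff R) cvg_b); apply: limr_ge; first exact: cvgP cvg_b.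
apply: nearW => i; rewrite -lee_fin -rE; apply: le_trans (nb_b i).
apply: le_measure; rewrite ?inE//.
  exact: (measurable_not_before hX threshold_rule_pos threshold_rule_adapted).
by move=> w /= Nw m _; rewrite Nw.
Qed.

Lemma threshold_rule_mean_stop : (mean_stop P N < +oo)%E.
Proof.
have [b [b01 nb_b]] := threshold_rule_not_before.
apply: (@le_lt_trans _ _ (\sum_(i <oo) (1 * b ^+ i)%:E)%E).
  by apply: lee_nneseries => // i _; rewrite mul1r.
by rewrite eseries_geometric// ltry.
Qed.

Lemma threshold_rule_stopping_rule : stopping_rule T tau P X N.
Proof.
split.
- exact: threshold_rule_pos.
- exact: threshold_rule_adapted.
- exact: threshold_rule_finite.
rewrite (expectation_stopped_time_cost hX hK hp0 hT htau threshold_rule_pos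
  threshold_rule_adapted threshold_rule_finite).
rewrite lte_add_pinfty ?ltry// lte_mul_pinfty ?threshold_rule_mean_stop//.
by rewrite lee_fin divr_ge0// ltW// (success_prob_gt0 hK hp0).
Qed.

(** The expected time is at least T and is finite by admissibility, so the extended-real quotient
    [throughput] is a genuine division. *)
Lemma stopping_rule_time_cost M : stopping_rule T tau P X M ->
  exists2 t : R, 0 < t & 'E_P[stopped (time_cost T tau X) M]%E = t%:E.
Proof.
move=> [M_pos M_adapted M_finite M_lty].
have TE : (T%:E <= 'E_P[stopped (time_cost T tau X) M])%E.
  rewrite (expectation_stopped_time_cost hX hK hp0 hT htau M_pos M_adapted M_finite).
  rewrite leeDl// mule_ge0 ?mean_stop_ge0// lee_fin divr_ge0// ltW//.
  exact: (success_prob_gt0 hK hp0).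
exists (fine 'E_P[stopped (time_cost T tau X) M]%E).
  rewrite -lte_fin fineK ?(lt_le_trans _ TE) ?lte_fin//.
  by rewrite ge0_fin_numE// (le_trans _ TE)// lee_fin ltW.
by rewrite fineK// ge0_fin_numE// (le_trans _ TE)// lee_fin ltW.
Qed.

Lemma throughput_le M : stopping_rule T tau P X M ->
  (throughput T tau Ps Pr P X M <= lam%:E)%E.
Proof.
move=> ruleM; have [t t0 Et] := stopping_rule_time_cost ruleM.
case: ruleM => M_pos M_adapted M_finite _.
rewrite /throughput Et inver gt_eqF// lee_pdivrMr// -Et.
exact: (expectation_stopped_reward_le hX hK hp0 hT htau hPs hPr M_pos
  M_adapted M_finite lam0 eq_lam).
Qed.

Lemma throughput_threshold_rule : throughput T tau Ps Pr P X N = lam%:E.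
Proof.
have [t t0 Et] := stopping_rule_time_cost threshold_rule_stopping_rule.
rewrite /throughput (expectation_stopped_reward_eq hX hK hp0 hT htau hPs hPr
  threshold_rule_pos threshold_rule_adapted threshold_rule_finite lam0 eq_lam
  threshold_rule_ge threshold_rule_lt).
by rewrite Et inver gt_eqF// -!EFinM mulfK// gt_eqF.
Qed.

End threshold_rule.

Theorem theorem1 (R : realType) (K L : nat) (hK : (1 <= K)%N) (hL : (1 <= L)%N)
    (T tau Ps Pr sf2 sg2 p0 : R)
    (hT : 0 < T) (htau : 0 < tau) (hPs : 0 < Ps) (hPr : 0 < Pr)
    (hsf2 : 0 < sf2) (hsg2 : 0 < sg2) (hp0 : 0 < p0 < 1)
    (d : measure_display) (Omega : measurableType d) (P : probability Omega R)
    (X : observations R K L Omega)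
    (hX : channel_model sf2 sg2 p0 P X) :
  (exists! lam : R, 0 <= lam /\ threshold_equation T tau Ps Pr p0 P X lam) /\
  forall lam : R, 0 <= lam -> threshold_equation T tau Ps Pr p0 P X lam ->
    stopping_rule T tau P X (threshold_rule Ps Pr X lam) /\
    throughput T tau Ps Pr P X (threshold_rule Ps Pr X lam) =
    ereal_sup [set throughput T tau Ps Pr P X N | N in stopping_rule T tau P X].
Proof.
split=> [|lam lam0 eq_lam].
  have [lam [lam0 eq_lam]] := threshold_exists hX hK hsg2 hp0 hT htau hPs hPr.
  exists lam; split=> // mu [_ eq_mu].
  exact: (threshold_unique hX hK hp0 hT htau hPs hPr eq_lam eq_mu).
have rule := threshold_rule_stopping_rule hX hK hp0 hT htau hPs hPr eq_lam.
split=> //; apply/eqP; rewrite eq_le; apply/andP; split.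
  by apply: ereal_sup_ubound; exists (threshold_rule Ps Pr X lam).
apply: ge_ereal_sup => _ [M ruleM <-].
rewrite (throughput_threshold_rule hX hK hp0 hT htau hPs hPr lam0 eq_lam).
exact: (throughput_le hX hK hp0 hT htau hPs hPr lam0 eq_lam ruleM).
Qed.
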